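(* Let $m$ be a nonnegative integer and let $f:[-1,1]\to\mathbb{R}$ be such that $f,f',\ldots,f^{(m-1)}$ are absolutely continuous on $\Omega=[-1,1]$ and $f^{(m)}$ is of bounded variation on $\Omega$, i.e. $V_m=\mathcal{V}(f^{(m)},\Omega)<\infty$. Let $f_n$ be the Legendre projection of $f$ of degree $n$. (i) For $m=0,1,\ldots$ and $n\ge m+1$, $$\|f-f_n\|_{L^2(\Omega)}\le\frac{V_m}{\sqrt{\pi(m+1/2)}\,(n-m)^{m+1/2}}.$$ (ii) For $m\ge1$ and $n\ge m+1$, $$\|f-f_n\|_{L^\infty(\Omega)}\le\begin{cases}\dfrac{4V_1}{\sqrt{2\pi(n-1)}}, & m=1,\\[3ex] \dfrac{2V_m/(m-1)}{\sqrt{2\pi(n+1-m)}}\displaystyle\prod_{k=1}^{m-1}\frac{1}{n-k+1/2}, & m\ge2.\end{cases}$$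
   Context: $P_k(x)$ denotes the Legendre polynomial of degree $k$, normalized by $P_k(1)=1$. The Legendre projection of degree $n$ is $f_n(x)=\sum_{k=0}^na_kP_k(x)$ with $a_k=(k+\frac12)\int_{-1}^1f(x)P_k(x)\,\mathrm{d}x$. The total variation of a function $g$ on $[-1,1]$ is $\mathcal{V}(g,[-1,1])=\sup\sum_{j=1}^{N}|g(x_j)-g(x_{j-1})|$, the supremum being over all partitions $-1=x_0<x_1<\cdots<x_N=1$. When $m=0$ the absolute continuity condition is empty. When $m\ge1$, the derivative $f^{(m)}$ of the absolutely continuous function $f^{(m-1)}$ exists almost everywhere; that $f^{(m)}$ is of bounded variation means that it coincides almost everywhere with a function on $[-1,1]$ of bounded variation (again denoted $f^{(m)}$), and $V_m$ is the total variation of that function. *)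

(* Defs.v *)
From HB Require Import structures.
From mathcomp Require Import all_boot all_order all_algebra.
From mathcomp Require Import all_classical all_reals all_analysis.

Set Implicit Arguments.
Unset Strict Implicit.
Unset Printing Implicit Defensive.

Import Order.TTheory GRing.Theory Num.Theory.
Import numFieldNormedType.Exports.

Local Open Scope classical_set_scope.
Local Open Scope ring_scope.

(* Functions on [-1, 1] are represented by total functions R -> R; no
   definition below depends on the values taken outside [-1, 1]. *)
Definition Omega (R : realType) : set R := `[-1, 1].
Arguments Omega R : clear implicits.

(* Rodrigues' formula, P_k = (2^k k!)^-1 d^k/dX^k (X^2 - 1)^k, which has the
   normalization P_k(1) = 1. *)
Definition legendre (R : realType) (k : nat) : {poly R} :=
  (2 ^+ k * k`!%:R)^-1 *: (('X^2 - 1) ^+ k)^`(k).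

Definition legendre_coef (R : realType) (f : R -> R) (k : nat) : R :=
  (k%:R + 2^-1) *
  \int[lebesgue_measure]_(x in Omega R) (f x * (legendre R k).[x]).

Definition legendre_proj (R : realType) (f : R -> R) (n : nat) (x : R) : R :=
  \sum_(k < n.+1) legendre_coef f k * (legendre R k).[x].

Definition abs_continuous (R : realType) (a b : R) (g : R -> R) : Prop :=
  forall e : R, 0 < e -> exists2 d : R, 0 < d &
    forall (N : nat) (s t : 'I_N -> R),
      (forall i, [&& a <= s i, s i < t i & t i <= b]) ->
      trivIset setT (fun i => `]s i, t i[%classic) ->
      \sum_(i < N) (t i - s i) < d ->
      \sum_(i < N) `|g (t i) - g (s i)| < e.

(* At an interior point of A this is the usual derivative; at an endpoint of an
   interval it is the one-sided one. *)
Definition has_derivative_within (R : realType) (A : set R) (g : R -> R)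
    (x l : R) : Prop :=
  (g y - g x) / (y - x) @[y --> within A x^'] --> l.

(* The norm of L^p(Omega): extending by 0 outside Omega changes neither the
   integrals of |g|^p over Omega nor the essential supremum of |g|. *)
Definition LpOmega_norm (R : realType) (p : \bar R) (g : R -> R) : \bar R :=
  'N[@lebesgue_measure R]_p [EFin \o (g \_ (Omega R))].

(* Main.v *)
(* The proof rests on the bound [|P_(k+1) - P_(k-1)| <= 4 / sqrt (2 pi k)] on [-1, 1].
   By the Legendre equation, [w = (1 - x^2) P_k'], which is proportional to
   [P_(k+1) - P_(k-1)], satisfies [(1 - x^2) w'' + k (k + 1) w = 0]; hence
   [w^2 + (1 - x^2) w'^2 / (k (k + 1))] is maximal at [0], where the values of
   [P_k] and [P_k'] are central binomial coefficients, and Wallis' formula gives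
   the sharp constant.

   Since [(2 k + 1) P_k = P_(k+1)' - P_(k-1)'] and [P_(k+1) - P_(k-1)] vanishes at
   [1] and [-1], one integration by parts against the measure [df^(m)] bounds the
   coefficients of [f^(m)], and [m] further ones, each of which expresses a
   coefficient of [f^(i)] by two of [f^(i+1)], give
   [|a_k| <= 2 V_m / sqrt (2 pi (k - m)) * \prod_(1 <= j <= m) 1 / (k - j + 1/2)].
   Both estimates follow by comparing [a_k^2 / (k + 1/2)] (for Parseval) and [|a_k|]
   (as [|P_k| <= 1]) with telescoping differences.  As polynomials are dense in L^2,
   the projections converge to [f] in L^2, which also identifies the uniform limit of
   [f_n] with [f] almost everywhere. *)

Require Import Defs.
From HB Require Import structures.
From mathcomp Require Import all_boot all_order all_algebra.
From mathcomp Require Import all_classical all_reals all_analysis.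
From mathcomp Require Import measurable_realfun ess_sup_inf polyorder polyrcf ring lra zify.

Set Implicit Arguments.
Unset Strict Implicit.
Unset Printing Implicit Defensive.

Import Order.TTheory GRing.Theory Num.Theory.
Import numFieldNormedType.Exports.

Local Open Scope classical_set_scope.
Local Open Scope ring_scope.

(** * Legendre polynomials *)

(** No measure [df^(m)] is constructed. It enters only through [|\int g Q'| <= M V] for a polynomial
    [Q] that vanishes at both ends and is bounded by [M], and this is proved on uniform partitions.

    Every [D i] is bounded: for [i < m] by absolute continuity, for [i = m] by bounded variation. So
    the fundamental theorem is needed only for absolutely continuous functions with a bounded almost
    everywhere derivative. Their primitive is then Lipschitz, and the matter reduces to the
    constancy of an absolutely continuous function with derivative zero almost everywhere.

    No series is summed either: an explicit nonnegative sequence whose decrements dominate the terms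
    is enough. The choice of this sequence explains the shape of the bounds. In L^2 every
    half-integer factor is weakened to a power of [k - m]. In the uniform norm with [m >= 2] the
    product telescopes exactly and the square root is frozen at its value for [n]. For [m = 1] the
    product has a single factor and cannot telescope by itself, so the square root has to. *)

Lemma derivn_mulX (R : nzRingType) (p : {poly R}) n :
  ('X * p)^`(n.+1) = 'X * p^`(n.+1) + p^`(n) *+ n.+1.
Proof.
have := derivnMXaddC n p 0.
by rewrite polyC0 addr0 -commr_polyX addrC -commr_polyX.
Qed.

Section LegendrePolynomials.
Variable R : realType.
Local Notation P := (legendre R).
Local Notation u k := (('X^2 - 1 : {poly R}) ^+ k).

Let c k : R := (2 ^+ k * k`!%:R)^-1.

Let c_neq0 k : c k != 0.
Proof. by rewrite invr_eq0 mulf_neq0 ?expf_neq0 ?pnatr_eq0 -?lt0n ?fact_gt0. Qed.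

Let cS k : c k.+1 *+ (2 * k.+1) = c k.
Proof.
rewrite /c exprS factS -mulr_natr !natrM; field.
by rewrite expf_neq0 ?pnatr_eq0 -?lt0n ?fact_gt0//= addrC natr1 pnatr_eq0.
Qed.

Let deriv_u k : (u k.+1)^`() = (u k * 'X) *+ (2 * k.+1).
Proof.
rewrite deriv_exp/= derivB derivXn derivC subr0/= expr1.
by rewrite mulrnAl -mulrnA commr_polyX.
Qed.

Lemma legendre0 : P 0%N = 1.
Proof. by rewrite /legendre !expr0 fact0 mulr1 invr1 scale1r derivn0. Qed.

Lemma legendre1 : P 1%N = 'X.
Proof.
rewrite /legendre derivn1 deriv_u expr0 mul1r expr1 (_ : 1`! = 1)%N// mulr1 muln1.
by rewrite -[X in _ *: X]scaler_nat scalerA mulVf ?scale1r ?pnatr_eq0.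
Qed.

Let deriv2_u k : (u k.+2)^`()^`() =
  (u k.+1 *+ (2 * k.+1).+1 + u k *+ (2 * k.+1)) *+ (2 * k.+2).
Proof.
rewrite deriv_u derivMn derivM derivX mulr1 deriv_u.
congr (_ *+ _); rewrite mulrnAl -mulrA -expr2.
rewrite [u k.+1]exprSr mulrBr mulr1 [RHS]addrC; move: (2 * k.+1)%N => n.
rewrite mulrnBl !mulrS; ring.
Qed.

(** By [deriv2_u], two derivatives of [u k.+2] leave a multiple of [u k.+1] plus a multiple of
    [u k]; the normalizations ([cS]) turn the [k]-th derivative of the second part into exactly
    [P k]. *)
Lemma legendreB k : P k.+2 - P k =
  (c k.+1 *+ (2 * k.+1).+1) *: (u k.+1)^`(k).
Proof.
rewrite /legendre -/(c k.+2) -/(c k) 2!derivSn deriv2_u derivnMn derivnD.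
rewrite !derivnMn -scaler_nat scalerA mulr_natr cS scalerDr.
rewrite -[_ *+ (2 * k.+1)]scaler_nat scalerA mulr_natr cS addrK.
by rewrite -scaler_nat scalerA mulr_natr.
Qed.

Lemma deriv_legendreB k : (P k.+2)^`() - (P k)^`() = P k.+1 *+ (2 * k.+1).+1.
Proof.
by rewrite -derivB legendreB derivZ -derivnS /legendre -scalerMnl.
Qed.

(** [u n] has zeros of order [n] at [1] and [-1], and each derivation removes only one factor
    [X^2 - 1]. *)
Let root_derivn_u x n k : (k < n)%N -> x ^+ 2 = 1 -> (u n)^`(k).[x] = 0.
Proof.
move=> kn x1.
have [q ->] : exists q : {poly R}, (u n)^`(k) = u (n - k) * q.
  elim: k kn => [|k IH] kn; first by exists 1; rewrite mulr1 subn0.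
  have [q Eq] := IH (ltnW kn).
  rewrite derivnS Eq derivM -(subnSK (ltnW kn)) deriv_u.
  exists (('X * q) *+ (2 * (n - k.+1).+1) + ('X^2 - 1) * q^`()).
  by rewrite [u _.+1]exprSr; move: (2 * _)%N (u _) => l v; ring.
rewrite hornerM horner_exp !hornerE x1 subrr.
by rewrite expr0n subn_eq0 leqNgt kn mul0r.
Qed.

Lemma legendreS2_sqr1 k x : x ^+ 2 = 1 -> (P k.+2).[x] = (P k).[x].
Proof.
move=> x1; apply/eqP; rewrite -subr_eq0 -hornerN -hornerD legendreB.
by rewrite hornerZ root_derivn_u ?mulr0.
Qed.

Lemma legendre_at1 k : (P k).[1] = 1.
Proof.
suff : (P k).[1] = 1 /\ (P k.+1).[1] = 1 by case.
elim: k => [|k [IH1 IH2]]; first by rewrite legendre0 legendre1 !hornerE.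
by rewrite legendreS2_sqr1 ?expr1n.
Qed.

Lemma legendre_atN1 k : (P k).[-1] = (-1) ^+ k.
Proof.
suff : (P k).[-1] = (-1) ^+ k /\ (P k.+1).[-1] = (-1) ^+ k.+1 by case.
elim: k => [|k [IH1 IH2]]; first by rewrite legendre0 legendre1 !hornerE.
by rewrite legendreS2_sqr1 ?sqrrN ?expr1n// IH2 IH1 !exprS !mulN1r opprK.
Qed.

Lemma size_legendre k : size (P k) = k.+1.
Proof.
have su : size (u k) = (2 * k).+1.
  have u0 : ('X^2 - 1 : {poly R}) != 0 by rewrite -polyC1 monic_neq0 ?monicXnsubC.
  by rewrite -[LHS]prednK ?size_poly_gt0 ?expf_neq0// size_exp -polyC1 size_XnsubC.
rewrite size_scale ?c_neq0//; apply/eqP; rewrite eqn_leq; apply/andP; split.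
  apply/leq_sizeP => j kj; rewrite coef_derivn nth_default ?mul0rn//.
  by rewrite su mul2n -addnn ltn_add2l.
rewrite ltnNge; apply/negP => /leq_sizeP/(_ k (leqnn k)).
rewrite coef_derivn => /eqP; rewrite mulrn_eq0 -leqn0 leqNgt ffact_gt0 leq_addl /=.
apply/negP; rewrite addnn -mul2n.
have -> : (u k)`_(2 * k) = lead_coef (u k) by rewrite /lead_coef su.
by rewrite lead_coef_eq0 -size_poly_eq0 su.
Qed.

(** For [n = k.+1], the power [v = u n] satisfies [(X^2 - 1) v' = 2 n X v]. Differentiating this
    [n + 1] times with the Leibniz rule for multiplication by [X] gives the Legendre equation for
    the [n]-th derivative of [v]. *)
Lemma legendre_ode k : (('X^2 - 1) * (P k)^`())^`() = P k *+ (k * k.+1).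
Proof.
case: k => [|k]; first by rewrite legendre0 derivC mulr0 derivC mul0n.
rewrite /legendre !derivZ -scalerAr derivZ scalerMnr; congr (_ *: _).
have E : ('X * ('X * (u k.+1)^`()) - (u k.+1)^`())^`(k.+2) =
    ('X * u k.+1)^`(k.+2) *+ (2 * k.+1).
  rewrite -derivnMn; congr derivn.
  rewrite mulrA -expr2 -{2}[(u k.+1)^`()]mul1r -mulrBl deriv_u.
  by rewrite mulrnAr mulrA -exprS commr_polyX.
move: E; rewrite derivnB !derivn_mulX -!derivSn derivM derivB derivXn derivC.
rewrite subr0 -!derivnS expr1; move: (u k.+1) => v E.
have -> : ('X^2 - 1) * v^`(k.+3) = 'X * ('X * v^`(k.+3)) - v^`(k.+3) by ring.
move: E; set a := v^`(k.+1); set b := v^`(k.+2); set d := v^`(k.+3).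
move: (k.+1) a b d => n a b d /eqP; rewrite -subr_eq0 => /eqP E.
by apply/eqP; rewrite -subr_eq0 -E; apply/eqP; ring.
Qed.

(** Both sides have the same derivative, by the Legendre equation and [deriv_legendreB], and both
    vanish at [1]. This transfers bounds on [(1 - x^2) P'] to differences of Legendre
    polynomials. *)
Lemma legendre_deriv_u k :
  ((1 - 'X^2) * (P k.+1)^`()) *+ (2 * k.+1).+1 = (P k - P k.+2) *+ (k.+1 * k.+2).
Proof.
set A : {poly R} := LHS; set B : {poly R} := RHS.
have dAB : (A - B)^`() = 0.
  rewrite derivB !derivMn -[1 - 'X^2]opprB mulNr derivN legendre_ode derivB.
  rewrite -[(P k)^`() - _]opprB deriv_legendreB !mulNrn opprK -!mulrnA.
  by rewrite [(_ * (2 * _).+1)%N]mulnC addNr.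
have : (size (A - B)%R <= 1)%N by rewrite -subn_eq0 subn1 -size_deriv dAB size_poly0.
move=> /size1_polyC E; apply/eqP; rewrite -subr_eq0 E -size_poly_eq0.
have := congr1 (horner^~ 1) E; rewrite hornerC => <-.
rewrite size_poly_eq0 polyC_eq0; apply/eqP.
rewrite /A /B hornerD hornerN !hornerMn hornerM !hornerD !hornerN.
by rewrite [(P k.+2).[1]]legendreS2_sqr1 ?expr1n// hornerC hornerXn expr1n
  !subrr mul0r !mul0rn subr0.
Qed.

Lemma coef_Xsub1_exp k i :
  (('X - 1 : {poly R}) ^+ k)`_i = (-1) ^+ (k - i) * 'C(k, i)%:R.
Proof.
rewrite addrC exprDn coef_sum.
have E (j : 'I_k.+1) : ((-1) ^+ (k - j) * 'X^j *+ 'C(k, j) : {poly R})`_i =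
   if j == i :> nat then (-1) ^+ (k - i) * 'C(k, i)%:R else 0.
  rewrite coefMn -[-1]/(- 1%:P) -polyCN -polyC_exp coefCM coefXn eq_sym.
  by case: eqVneq => [->|]; rewrite ?mulr1 ?mulr_natr ?mulr0 ?mul0rn.
rewrite (eq_bigr _ (fun j _ => E j)) -big_mkcond/=.
have [ik|ki] := ltnP i k.+1; first by rewrite (big_pred1 (Ordinal ik)).
by rewrite bin_small// mulr0 big_pred0// => j; rewrite ltn_eqF// (leq_trans (ltn_ord j)).
Qed.

(** Only even powers of [X] occur in [u k], so a coefficient read at [0] either vanishes by parity
    or is a signed binomial coefficient. *)
Let u_comp k : u k = (('X - 1) ^+ k) \Po 'X^2.
Proof. by rewrite rmorphXn/= comp_polyB comp_polyX comp_polyC. Qed.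

(** Only the squares of the values at [0] enter the estimates, so the alternating signs are dropped
    here. *)
Let sqr_sign_eq (s a b : R) : s ^+ 2 = 1 -> a = s * b -> a ^+ 2 = b ^+ 2.
Proof. by move=> s1 ->; rewrite exprMn s1 mul1r. Qed.

Lemma legendre_at0_even p : (P (2 * p)).[0] ^+ 2 = ('C(2 * p, p)%:R / 4 ^+ p) ^+ 2.
Proof.
rewrite horner_coef0 coefZ coef_derivn addn0 u_comp coef_comp_poly_Xn// dvdn_mulr//.
rewrite [in X in _`_X]mulKn// coef_Xsub1_exp ffactnn.
apply: (@sqr_sign_eq _ _ _ (sqrr_sign R (2 * p - p))).
rewrite exprM -natrX expnS expn1 -[(2 * 2)%N]/4%N; field.
by rewrite expf_neq0 ?pnatr_eq0 -?lt0n ?fact_gt0.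
Qed.

Lemma legendre_at0_odd p : (P (2 * p).+1).[0] = 0.
Proof.
rewrite horner_coef0 coefZ coef_derivn addn0 u_comp coef_comp_poly_Xn//.
by rewrite dvdn2 /= mul2n odd_double mul0rn mulr0.
Qed.

Lemma deriv_legendre_at0_even p : (P (2 * p))^`().[0] = 0.
Proof.
rewrite horner_coef0 coef_deriv coefZ coef_derivn addn1 u_comp coef_comp_poly_Xn//.
by rewrite dvdn2 /= mul2n odd_double mul0rn mulr0.
Qed.

Lemma deriv_legendre_at0_odd p :
  (P (2 * p).+1)^`().[0] ^+ 2 = ((2 * p).+1%:R * 'C(2 * p, p)%:R / 4 ^+ p) ^+ 2.
Proof.
rewrite horner_coef0 coef_deriv coefZ coef_derivn addn1 u_comp coef_comp_poly_Xn//.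
have -> : (2 * p).+2 = (2 * p.+1)%N by lia.
rewrite dvdn_mulr// mulKn// coef_Xsub1_exp mulr1n.
have -> : (2 * p.+1) ^_ (2 * p).+1 = (((2 * p).+1)`! * (2 * p.+1))%N.
  by rewrite mulnS [RHS]mulnC -factS -(@ffact_fact _ (2 * p).+1)// subSnn muln1.
apply: (@sqr_sign_eq _ _ _ (sqrr_sign R ((2 * p).+1 - p.+1))).
have E : 'C((2 * p).+1, p.+1)%:R * p.+1%:R = (2 * p).+1%:R * 'C(2 * p, p)%:R :> R.
  by rewrite -!natrM mulnC mul_bin_diag.
rewrite -E.
have -> : (2 ^+ (2 * p).+1 : R) = 2 * 4 ^+ p.
  by rewrite exprS exprM -natrX.
move: ((2 * p).+1)`! (fact_gt0 (2 * p).+1) ((-1) ^+ _) => a a0 b; field.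
by rewrite expf_neq0 ?pnatr_eq0 -?lt0n.
Qed.

(** The step shared by both Sonin arguments: [S'] has the sign of [x], so [S] grows away from the
    origin. Applied to [S] it puts the maximum at the endpoints, applied to [- S] at the origin. *)
Lemma horner_le_outward (S q : {poly R}) x y : S^`() = 'X * q ->
  (forall z, 0 <= q.[z]) -> (0 <= x <= y) || (y <= x <= 0) -> S.[x] <= S.[y].
Proof.
move=> dS q0 /orP[] /andP[xy xy'].
  apply: (@ler_hornerW _ 0 y S); rewrite ?in_itv/= ?lexx ?xy ?xy' ?(le_trans xy)//.
  move=> z; rewrite in_itv/= => /andP[/ltW z0 _].
  by rewrite dS hornerM hornerX mulr_ge0.
rewrite -lerN2 -!hornerN.
apply: (@ler_hornerW _ y 0 (- S)); rewrite ?in_itv/= ?lexx ?xy ?xy' ?(le_trans xy)//.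
move=> z; rewrite in_itv/= => /andP[_ /ltW z0].
by rewrite derivN dS hornerN hornerM hornerX oppr_ge0 mulr_le0_ge0.
Qed.

Let ode2 k : (1 - 'X^2) * (P k)^`()^`() = 'X * (P k)^`() *+ 2 - P k *+ (k * k.+1).
Proof.
by rewrite -legendre_ode derivM derivB derivXn derivC subr0 expr1 /=; ring.
Qed.

(* Sonin's method: by the differential equation, [k (k + 1) P^2 + (1 - x^2) P'^2]
   has derivative [2 x P'^2], so that it is maximal at [1] and [-1]. *)
Lemma legendre_le1 k x : -1 <= x <= 1 -> `|(P k).[x]| <= 1.
Proof.
case: k => [|k] x1; first by rewrite legendre0 hornerC normr1.
pose n := (k.+1 * k.+2)%N.
pose S : {poly R} := (P k.+1) ^+ 2 *+ n + (1 - 'X^2) * ((P k.+1)^`()) ^+ 2.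
have dS : S^`() = 'X * (((P k.+1)^`()) ^+ 2 *+ 2).
  have E := ode2 k.+1.
  rewrite /S derivD derivMn derivM [in X in _ + X](_ : _ ^+ 2 =
    (P k.+1)^`() * (P k.+1)^`())// !derivM derivB derivXn derivC sub0r expr1 /=.
  transitivity (P k.+1 * (P k.+1)^`() *+ 2 *+ n - 'X * ((P k.+1)^`()) ^+ 2 *+ 2
    + (P k.+1)^`() * ((1 - 'X^2) * (P k.+1)^`()^`()) *+ 2); first by ring.
  by rewrite E -/n; ring.
have S0 z : 0 <= (((P k.+1)^`()) ^+ 2 *+ 2).[z].
  by rewrite hornerMn horner_exp mulrn_wge0 ?sqr_ge0.
have S1 y : y ^+ 2 = 1 -> S.[y] = n%:R.
  move=> y1; rewrite /S hornerD hornerMn horner_exp hornerM hornerD hornerN hornerXn y1.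
  rewrite hornerC subrr mul0r addr0.
  have : y == 1 \/ y == -1.
    by apply/orP; rewrite -eqf_sqr expr1n y1.
  by case=> /eqP ->; rewrite ?legendre_at1 ?legendre_atN1 ?sqrr_sign ?expr1n.
have Sx : S.[x] <= n%:R.
  have [x0|x0] := leP 0 x.
    rewrite -(S1 1) ?expr1n//; apply: (horner_le_outward dS) => //.
    by rewrite x0 (andP x1).2.
  rewrite -(S1 (-1)) ?sqrrN ?expr1n//; apply: (horner_le_outward dS) => //.
  by rewrite (ltW x0) (andP x1).1 orbT.
have n0 : (0 : R) < n%:R by rewrite ltr0n.
rewrite -ler_sqr ?nnegrE// expr1n real_normK ?num_real//.
rewrite -(ler_pM2r n0) mul1r; apply: le_trans Sx.
rewrite /S hornerD hornerMn horner_exp mulr_natr lerDl hornerM horner_exp.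
rewrite mulr_ge0 ?sqr_ge0// hornerD hornerN hornerXn hornerC subr_ge0.
by case/andP: x1 => ? ?; nra.
Qed.

(* Sonin's method again, now for [w = (1 - x^2) P']: the expression
   [w^2 + k (k + 1) (1 - x^2) P^2] is maximal at [0]. *)
Lemma legendre_deriv_bound k x : -1 <= x <= 1 ->
  ((1 - x ^+ 2) * (P k)^`().[x]) ^+ 2 <=
  (P k)^`().[0] ^+ 2 + (k * k.+1)%:R * (P k).[0] ^+ 2.
Proof.
move=> x1; set n := (k * k.+1)%N.
pose w : {poly R} := (1 - 'X^2) * (P k)^`().
pose S : {poly R} := w ^+ 2 + ((1 - 'X^2) * (P k) ^+ 2) *+ n.
have dw : w^`() = - (P k *+ n).
  by rewrite -legendre_ode -derivN -mulNr opprB.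
have dS : (- S)^`() = 'X * ((P k) ^+ 2 *+ n *+ 2).
  rewrite /S derivN derivD derivMn [w ^+ 2]expr2 [P k ^+ 2]expr2.
  rewrite [(w * w)^`()]derivM dw !derivM.
  by rewrite derivB derivXn derivC sub0r expr1 /w /=; ring.
have S0 z : 0 <= ((P k) ^+ 2 *+ n *+ 2).[z].
  by rewrite !hornerMn horner_exp !mulrn_wge0 ?sqr_ge0.
have : S.[x] <= S.[0].
  rewrite -lerN2 -!hornerN; apply: (horner_le_outward dS) => //.
  by rewrite !lexx andbT /= le_total.
have -> : S.[0] = (P k)^`().[0] ^+ 2 + n%:R * (P k).[0] ^+ 2.
  rewrite /S /w hornerD hornerMn horner_exp !hornerM hornerD hornerN hornerXn.
  by rewrite -expr2 hornerC expr0n subr0 !mul1r mulr_natl.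
apply: le_trans; rewrite /S /w hornerD hornerMn horner_exp !hornerM hornerD.
rewrite hornerN hornerXn hornerC -expr2 lerDl mulrn_wge0// mulr_ge0 ?sqr_ge0//.
by case/andP: x1 => ? ?; nra.
Qed.

End LegendrePolynomials.

(** * Wallis' inequality *)

Section Wallis.
Variable R : realType.
Local Notation mu := (@lebesgue_measure R).

Lemma Rintegral_FTC2 (f F : R -> R) (a b : R) : a < b -> continuous f ->
  (forall x : R, is_derive x 1 F (f x)) ->
  \int[mu]_(x in `[a, b]) f x = F b - F a.
Proof.
move=> ab cf dF; rewrite /Rintegral (@continuous_FTC2 _ f F)//.
- exact/continuous_subspaceT.
- have cF x : {for x, continuous F}.
    by apply: differentiable_continuous; apply/derivable1_diffP; apply: ex_derive.
  split; first by move=> x _; apply: ex_derive.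
  + exact/cvg_at_right_filter/cF.
  + exact/cvg_at_left_filter/cF.
- by move=> x _; rewrite derive1E; apply: derive_val.
Qed.

Let W n : R := \int[mu]_(x in `[0, pi / 2]) (cos x) ^+ n.

Let pihalf_gt0 : 0 < pi / 2 :> R. Proof. by rewrite divr_gt0// pi_gt0. Qed.

Let cos_exp_continuous n : continuous (fun x : R => cos x ^+ n).
Proof.
move=> x; apply: (@continuous_comp _ _ _ cos (fun y => y ^+ n)).
  exact: continuous_cos.
exact: exprn_continuous.
Qed.

Let W_integrable n : mu.-integrable `[0, pi / 2] (EFin \o (fun x => cos x ^+ n)).
Proof.
apply: continuous_compact_integrable; first exact: segment_compact.
exact/continuous_subspaceT/cos_exp_continuous.
Qed.

Let W0 : W 0 = pi / 2.
Proof.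
rewrite /W; under eq_Rintegral do rewrite expr0.
by rewrite Rintegral_cst//= lebesgue_measure_itv/= lte_fin pihalf_gt0 -EFinB subr0 mul1r.
Qed.

Let W1 : W 1 = 1.
Proof.
rewrite /W; under eq_Rintegral do rewrite expr1.
rewrite (@Rintegral_FTC2 _ sin)// ?sin_pihalf ?sin0 ?subr0//.
exact: continuous_cos.
Qed.

(** The difference of the two integrands is the derivative of [sin * cos ^+ n.+1], which vanishes at
    [0] and at [pi / 2]. *)
Let WSS n : n.+2%:R * W n.+2 = n.+1%:R * W n.
Proof.
apply/eqP; rewrite -subr_eq0 -!RintegralZl//; apply/eqP.
have I (k l : nat) : mu.-integrable `[0, pi / 2] (EFin \o (fun x => k%:R * cos x ^+ l)).
  apply: continuous_compact_integrable; first exact: segment_compact.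
  apply/continuous_subspaceT => x; apply: cvgM; first exact: cvg_cst.
  exact: cos_exp_continuous.
rewrite -RintegralB//; [|exact: I..].
have D (x : R) : is_derive x 1 (sin * cos ^+ n.+1 : R -> R)
    (n.+2%:R * cos x ^+ n.+2 - n.+1%:R * cos x ^+ n).
  apply: is_derive_eq.
  rewrite /GRing.scale/=.
  rewrite [in X in _ + X = _]exprfctE -[n.+2%:R]natr1 !exprS; have := sin2cos2 x.
  move: (sin x) (cos x) => s t E.
  transitivity (t * t * t ^+ n - s ^+ 2 * (n.+1%:R * t ^+ n)); first by ring.
  by rewrite E; ring.
rewrite (@Rintegral_FTC2 _ (sin * cos ^+ n.+1))//.
  have FE (y : R) : (sin * cos ^+ n.+1) y = sin y * cos y ^+ n.+1
    by transitivity (sin y * (cos ^+ n.+1) y); rewrite ?exprfctE.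
  by rewrite !FE cos_pihalf sin0 !exprS !(mul0r, mulr0) subrr.
move=> x; apply: cvgB; apply: cvgM; try exact: cvg_cst; exact: cos_exp_continuous.
Qed.

Let W_le n : W n.+1 <= W n.
Proof.
apply: le_Rintegral => // x; rewrite /= in_itv/= => /andP[x0 x1].
rewrite exprS ler_piMl ?cos_le1// exprn_ge0//.
by rewrite cos_ge0_pihalf// x1 andbT (le_trans _ x0)// oppr_le0 ltW.
Qed.

(** This is the absolute value of [P_(2p)] at [0]; it also determines the Wallis integrals of both
    parities, by [W_even] and [W_odd]. *)
Let c p : R := 'C(2 * p, p)%:R / 4 ^+ p.

Let c_gt0 p : 0 < c p.
Proof. by rewrite divr_gt0 ?exprn_gt0// ltr0n bin_gt0 leq_pmull. Qed.

Let cS p : c p.+1 * (2 * p%:R + 2) = c p * (2 * p%:R + 1).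
Proof.
have E : (p.+1 * 'C(2 * p.+1, p.+1) = 2 * (2 * p).+1 * 'C(2 * p, p))%N.
  apply/eqP; rewrite -(@eqn_pmul2l p.+1)//; apply/eqP.
  have E1 := mul_bin_diag (2 * p).+2 p; have E2 := mul_bin_diag (2 * p).+1 p.
  have E3 := mul_bin_left (2 * p).+1 p.
  have E4 : ((2 * p).+1 - p = p.+1)%N by lia.
  move: E1 E2 E3; rewrite E4 mulnS -[(2 + 2 * p)%N]/(2 * p).+2 /= => E1 E2 E3.
  rewrite -E1; nia.
have E' : p.+1%:R * 'C(2 * p.+1, p.+1)%:R = 2 * (2 * p%:R + 1) * 'C(2 * p, p)%:R :> R.
  by rewrite -natrM E 2!natrM -[(2 * p).+1]addn1 natrD natrM.
rewrite /c exprS; move: E'; rewrite -natr1.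
set a := 'C(2 * p.+1, _)%:R; set b := 'C(_, _)%:R => E'.
have -> : a / (4 * 4 ^+ p) * (2 * p%:R + 2) = ((p%:R + 1) * a) / (2 * 4 ^+ p).
  by field; rewrite expf_neq0.
by rewrite E'; field; rewrite expf_neq0.
Qed.

Let W_even p : W (2 * p) = pi / 2 * c p.
Proof.
elim: p => [|p IH]; first by rewrite W0 /c bin0 expr0 divr1 mulr1.
have E := WSS (2 * p); have C := cS p; rewrite IH in E.
have n0 : 2 * p%:R + 2 != 0 :> R by rewrite gt_eqF// ltr_wpDl ?mulr_ge0.
apply: (mulfI n0); rewrite [RHS]mulrC -[RHS]mulrA C mulnS.
move: E; rewrite -[(2 + 2 * p)%N]/(2 * p).+2 -!natr1 natrM.
move: (W _) (c p) (pi : R) => w a q E.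
by transitivity ((2 * p%:R + 1 + 1) * w); [ring|rewrite E; ring].
Qed.

Let W_odd p : W (2 * p).+1 * ((2 * p%:R + 1) * c p) = 1.
Proof.
elim: p => [|p IH]; first by rewrite W1 /c bin0 expr0 divr1 mulr0 add0r !mulr1.
have E := WSS (2 * p).+1; have C := cS p.
have n0 : 2 * p%:R + 2 != 0 :> R by rewrite gt_eqF// ltr_wpDl ?mulr_ge0.
move: E; rewrite mulnS -[(2 + 2 * p)%N]/(2 * p).+2 -!natr1 natrM => E.
apply: (mulfI n0).
move: E C IH; move: (W _) (W _) (c _) (c _) => a b d e E C IH.
transitivity ((2 * p%:R + 1 + 1 + 1) * b * (e * (2 * p%:R + 2))); first by ring.
rewrite C E; transitivity ((a * ((2 * p%:R + 1) * d)) * (2 * p%:R + 2)); first by ring.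
by rewrite IH mulrC.
Qed.

(** This is [W (2 p) <= W (2 p - 1)] rewritten with [W_even], [W_odd] and the recursion [cS]. *)
Let c_le p : (0 < p)%N -> c p ^+ 2 * p%:R <= pi^-1.
Proof.
case: p => // p _; have WE := W_le (2 * p).+1; have Ho := W_odd p.
have He := W_even p.+1; have C := cS p; have C0 := c_gt0 p; have C1 := c_gt0 p.+1.
move: He; rewrite mulnS -[(2 + 2 * p)%N]/(2 * p).+2 => He; rewrite He in WE.
have := pi_gt0 R; move: (pi : R) WE => q WE q0; rewrite -natr1.
rewrite -(@ler_pM2l _ q)// mulfV ?gt_eqF//.
move: WE Ho C C0 C1; clear He; move: (W _) (c p) (c p.+1) => w a b WE Ho C a0 b0.
apply: (@le_trans _ _ (w * (b * (2 * p%:R + 2)))).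
  have -> : q * (b ^+ 2 * (p%:R + 1)) = (q / 2 * b) * (b * (2 * p%:R + 2)) by field.
  by rewrite ler_wpM2r ?mulr_ge0 ?addr_ge0 ?mulr_ge0// ltW.
by rewrite C [a * _]mulrC Ho.
Qed.

(** With the weight [4 q + 1], all terms but the constant cancel in [(4 q + 5) (2 q + 1)^2 - (4 q +
    1) (2 q + 2)^2 = 1], so each increment is exactly [c q ^+ 2 / (2 q + 2) ^+ 2]. *)
Let c_incr p q : (p <= q)%N -> (4 * p%:R + 1) * c p ^+ 2 <= (4 * q%:R + 1) * c q ^+ 2.
Proof.
elim: q => [|q IH]; first by rewrite leqn0 => /eqP ->.
rewrite leq_eqVlt => /predU1P[->//|/IH /le_trans]; apply.
have E := cS q; have c0 := c_gt0 q; have c1 := c_gt0 q.+1; rewrite -[q.+1%:R]natr1.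
have := ler0n R q; move: (q%:R) (c q) (c q.+1) E c0 c1 => x a b E a0 b0 x0.
have x2 : 0 < 2 * x + 2 by lra.
rewrite -(@ler_pM2r _ ((2 * x + 2) ^+ 2)) ?exprn_gt0//.
rewrite -[leRHS]mulrA -exprMn E -subr_ge0 (_ : _ - _ = a ^+ 2) ?sqr_ge0//; ring.
Qed.

(* The left-hand side increases with [p], and tends to [4 / pi] by Wallis' formula. *)
Lemma central_binomial_le p :
  (4 * p%:R + 1) * ('C(2 * p, p)%:R / 4 ^+ p) ^+ 2 <= 4 / pi :> R.
Proof.
rewrite -/(c p); apply/ler_addgt0Pr => e e0.
(* [c_le] bounds [4 q c_q^2] by [4 / pi]; a large [q] makes the remaining term [c_q^2 <= pi^-1 / q]
   at most [e]. *)
pose q := maxn p.+1 (Num.truncn (pi^-1 / e : R)).+1.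
have q0 : (0 < q)%N by rewrite leq_max.
apply: le_trans (c_incr (_ : p <= q)%N) _; first by rewrite ltnW// leq_max leqnn.
have Q0 : (0 : R) < q%:R by rewrite ltr0n.
have C := c_le q0.
have : pi^-1 / e <= q%:R.
  rewrite (le_trans (ltW (truncnS_gt _)))// ler_nat leq_max leqnn orbT//.
rewrite ler_pdivrMr// => qe.
have : c q ^+ 2 <= pi^-1 / q%:R by rewrite ler_pdivlMr.
have : pi^-1 / q%:R <= e by rewrite ler_pdivrMr// mulrC.
by move=> h1 h2; rewrite mulrDl mul1r; nra.
Qed.
End Wallis.

(** Squaring [legendre_deriv_u] reduces the claim to the Sonin bound at the origin. There, by
    parity, only one of the values of [P_K] and [P_K'] survives ([K = k.+1]), and
    [central_binomial_le] controls it. *)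
Lemma legendreB_bound (R : realType) k (x : R) : -1 <= x <= 1 ->
  `|(legendre R k.+2).[x] - (legendre R k).[x]| <= 4 / Num.sqrt (2 * pi * k.+1%:R).
Proof.
move=> x1; have pi0 := pi_gt0 R.
have k0 : (0 : R) < k.+1%:R by rewrite ltr0n.
rewrite -ler_sqr ?nnegrE ?divr_ge0 ?sqrtr_ge0// real_normK ?num_real//.
rewrite expr_div_n sqr_sqrtr ?mulr_ge0 ?(ltW pi0) ?(ltW k0)//.
have E : (2 * k.+1).+1%:R * ((1 - x ^+ 2) * (legendre R k.+1)^`().[x]) =
    (k.+1%:R * k.+2%:R) * ((legendre R k).[x] - (legendre R k.+2).[x]).
  have := congr1 (horner^~ x) (legendre_deriv_u R k).
  rewrite /= !hornerMn hornerM !hornerD !hornerN hornerXn hornerC => E.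
  by rewrite -natrM mulr_natl E mulr_natl.
have := legendre_deriv_bound k.+1 x1.
set d := (_ - _) in E *; move: E; set w := (1 - _) * _.
set K : R := k.+1%:R => E B.
have K2 : k.+2%:R = K + 1 by rewrite -natr1.
have KK : (2 * k.+1).+1%:R = 2 * K + 1 by rewrite -natr1 natrM.
rewrite -sqrrN opprB -/d.
move: E B; rewrite K2 KK natrM K2 -/K => E B.
suff : (2 * K + 1) ^+ 2 * w ^+ 2 <= (K * (K + 1)) ^+ 2 * (8 / (pi * K)).
  rewrite -exprMn E exprMn ler_pM2l ?exprn_gt0 ?mulr_gt0 ?addr_gt0//.
  move=> /le_trans; apply; rewrite le_eqVlt; apply/orP; left; apply/eqP.
  have [K0 p0] : K != 0 /\ (pi : R) != 0 by rewrite !gt_eqF.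
  by clear -K0 p0; clearbody K; move: (pi : R) p0 => q q0; field; rewrite K0 q0.
apply: le_trans (ler_wpM2l _ B) _; first by rewrite sqr_ge0.
rewrite {B E w d}; have [p [kp|kp]] : exists p, k.+1 = (2 * p).+1 \/ k.+1 = (2 * p.+1)%N.
  by exists (k./2); lia.
  rewrite kp legendre_at0_odd expr0n mulr0 addr0 deriv_legendre_at0_odd.
  rewrite -mulrA exprMn -kp -/K; have := central_binomial_le R p.
  set u := (_ / _) ^+ 2 => uB.
  (* The general odd case ends in [2 K^2 - K - 2 >= 0], which fails for [K = 1]. There the claim is
     [9 pi <= 32], and [central_binomial_le] at [1] already gives [pi <= 16 / 5]. *)
  have [p0|p0] := posnP p.
    have := central_binomial_le R 1.
    have -> : K = 1 by rewrite /K kp p0.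
    rewrite /u p0 bin0 expr0 divr1 !expr1n -[(2 * 1)%N]/2%N bin1 expr1 mulr1 => p1.
    have : pi * (5 / 4) <= (4 : R).
      by rewrite mulrC -ler_pdivlMr//; apply: le_trans p1; lra.
    by move=> ?; rewrite !mul1r mulr1 (_ : (1 + 1) ^+ 2 = 4) ?mulrA ?ler_pdivlMr//; nra.
  have KE : K = 2 * p%:R + 1 by rewrite /K kp -natr1 natrM.
  have p1 : 1 <= p%:R :> R by rewrite ler1n.
  have uB' : u <= 4 / (pi * (2 * K - 1)).
    rewrite ler_pdivlMr ?mulr_gt0//; last by rewrite KE; lra.
    by rewrite mulrCA mulrC -ler_pdivlMr// mulrC; apply: le_trans uB; rewrite KE; lra.
  apply: (@le_trans _ _ ((2 * K + 1) ^+ 2 * (K ^+ 2 * (4 / (pi * (2 * K - 1)))))).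
    by rewrite !ler_wpM2l ?sqr_ge0.
  have K1 : 3 <= K by rewrite KE; lra.
  have K20 : 0 < 2 * K - 1 by lra.
  have -> : (2 * K + 1) ^+ 2 * (K ^+ 2 * (4 / (pi * (2 * K - 1)))) =
      4 * K ^+ 2 * ((2 * K + 1) ^+ 2 * K) / (pi * K * (2 * K - 1)).
    by clear -pi0 k0 K20; move: (pi : R) pi0 => q q0; field; rewrite !gt_eqF.
  have -> : (K * (K + 1)) ^+ 2 * (8 / (pi * K)) =
      4 * K ^+ 2 * (2 * (K + 1) ^+ 2 * (2 * K - 1)) / (pi * K * (2 * K - 1)).
    by clear -pi0 k0 K20; move: (pi : R) pi0 => q q0; field; rewrite !gt_eqF.
  rewrite ler_pM2r ?invr_gt0 ?mulr_gt0// ler_wpM2l ?mulr_ge0 ?sqr_ge0//.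
  rewrite -subr_ge0 (_ : _ - _ = 2 * K ^+ 2 - K - 2); last by ring.
  by nra.
rewrite kp deriv_legendre_at0_even expr0n add0r legendre_at0_even.
have := central_binomial_le R p.+1; set u := (_ / _) ^+ 2.
have -> : 4 * p.+1%:R + 1 = 2 * K + 1 by rewrite /K kp natrM; ring.
move=> uB; rewrite mulrCA.
have -> : (K * (K + 1)) ^+ 2 * (8 / (pi * K)) = K * (K + 1) * ((K + 1) * 2 * (4 / pi)).
  by clear -pi0 k0; move: (pi : R) pi0 => q q0; field; rewrite !gt_eqF.
rewrite ler_wpM2l ?mulr_ge0 ?addr_ge0 ?(ltW k0)// expr2 -[leLHS]mulrA.
have K0 : 0 < K by [].
apply: ler_pM => //; [lra| |lra].
by rewrite mulr_ge0 ?sqr_ge0//; lra.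
Qed.

(** * Absolutely continuous functions *)

Section DerivativeWithin.
Variable R : realType.
Implicit Types (A : set R) (F G : R -> R) (a b x l : R).

Lemma has_derivative_within_bound A F x l e : has_derivative_within A F x l ->
  0 < e -> exists2 d, 0 < d &
    forall y, A y -> `|y - x| < d -> `|F y - F x - l * (y - x)| <= e * `|y - x|.
Proof.
move=> /cvgrPdist_le /(_ e) + e0 => /(_ e0).
move=> /nbhs_ballP[d /= d0 dP]; exists d => // y Ay yx.
have [->|yx0] := eqVneq y x; first by rewrite !subrr mulr0 subrr normr0 mulr0.
have xy0 : y - x != 0 by rewrite subr_eq0.
have := dP y; rewrite /ball/= distrC => /(_ yx yx0 Ay).
rewrite -(@ler_pM2r _ `|y - x|) ?normr_gt0// -normrM mulrBl divfK//.
by rewrite distrC.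
Qed.

Lemma is_derive_within A F x l : is_derive x (1 : R) F l -> has_derivative_within A F x l.
Proof.
move=> /is_derive1_caratheodory[g [Fg cg gx]].
rewrite -gx; apply: (@cvg_trans _ (g y @[y --> within A x^'])).
  apply: near_eq_cvg.
  change (nbhs x (fun y => y != x -> A y -> (g y = (F y - F x) / (y - x)))).
  by apply: filterE => y yx _; rewrite Fg mulfK// subr_eq0.
apply: cvg_trans cg; apply: cvg_app.
by move=> P nP; apply: filterS nP => y Py _ _.
Qed.

Lemma has_derivative_withinB A F G x l k : has_derivative_within A F x l ->
  has_derivative_within A G x k -> has_derivative_within A (F \- G) x (l - k).
Proof.
move=> dF dG; rewrite /has_derivative_within.
apply: cvg_trans (cvgB dF dG); apply: near_eq_cvg; apply: nearW => y /=.
by rewrite -[LHS]/((F y - F x) / (y - x) - (G y - G x) / (y - x)) -mulrBl; congr (_ * _); ring.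
Qed.

Lemma has_derivative_withinM A F G x l k : has_derivative_within A F x l ->
  has_derivative_within A G x k -> {for x, continuous G} ->
  has_derivative_within A (F \* G) x (l * G x + F x * k).
Proof.
move=> dF dG cG; rewrite /has_derivative_within.
have cG' : G y @[y --> within A x^'] --> G x.
  apply: cvg_trans cG; apply: cvg_app.
  by move=> P nP; apply: filterS nP => y Py _ _.
apply: cvg_trans (cvgD (cvgM dF cG') (cvgM (cvg_cst (F x)) dG)).
apply: near_eq_cvg; apply: nearW => y /=.
rewrite -[LHS]/((F y - F x) / (y - x) * G y + F x * ((G y - G x) / (y - x))).
by rewrite mulrAC mulrA -mulrDl; congr (_ * _); ring.
Qed.

End DerivativeWithin.

Section AbsolutelyContinuous.
Variable R : realType.
Variables (a b : R).
Local Notation mu := (@lebesgue_measure R).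
Implicit Types (F G : R -> R).

(** One statement that covers both closure properties needed later: differences, and products with a
    polynomial. *)
Lemma abs_continuous_dominated F G H K : 
  (forall s t, a <= s -> s < t -> t <= b ->
     `|H t - H s| <= K * (`|F t - F s| + `|G t - G s|)) ->
  abs_continuous a b F -> abs_continuous a b G -> abs_continuous a b H.
Proof.
move=> HFG acF acG e e0; pose e' := e / (2 * (`|K| + 1)).
have K1 : 0 < `|K| + 1 by rewrite ltr_wpDl.
have e'0 : 0 < e' by rewrite divr_gt0// mulr_gt0.
have [d1 d10 H1] := acF _ e'0; have [d2 d20 H2] := acG _ e'0.
exists (Num.min d1 d2); first by rewrite lt_min d10.
move=> N s t st dst; rewrite lt_min => /andP[sd1 sd2].
have {}H1 := H1 _ _ _ st dst sd1; have {}H2 := H2 _ _ _ st dst sd2.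
apply: (@le_lt_trans _ _ ((`|K| + 1) * (\sum_(i < N) `|F (t i) - F (s i)| +
   \sum_(i < N) `|G (t i) - G (s i)|))).
  rewrite -big_split/= mulr_sumr; apply: ler_sum => i _.
  have /and3P[? ? ?] := st i; apply: le_trans (HFG _ _ _ _ _) _ => //.
  by rewrite ler_wpM2r ?addr_ge0// ler_wpDr// ler_norm.
rewrite mulrC -ltr_pdivlMr// (lt_le_trans (ltrD H1 H2))//.
have -> : e' + e' = e / (`|K| + 1) by rewrite /e'; field; rewrite gt_eqF.
by [].
Qed.

Lemma lipschitz_abs_continuous F L :
  (forall s t, a <= s -> s < t -> t <= b -> `|F t - F s| <= L * (t - s)) ->
  abs_continuous a b F.
Proof.
move=> FL e e0; have L1 : 0 < `|L| + 1 by rewrite ltr_wpDl.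
exists (e / (`|L| + 1)); first by rewrite divr_gt0.
move=> N s t st _; rewrite ltr_pdivlMr// mulrC; apply: le_lt_trans.
rewrite mulr_sumr; apply: ler_sum => i _; have /and3P[? st' ?] := st i.
apply: le_trans (FL _ _ _ _ _) _ => //; rewrite ler_wpM2r ?subr_ge0 ?(ltW st')//.
by rewrite ler_wpDr// ler_norm.
Qed.

Lemma abs_continuous_dist F e : abs_continuous a b F -> 0 < e ->
  exists2 d, 0 < d & forall s t, a <= s <= b -> a <= t <= b -> `|t - s| < d ->
    `|F t - F s| < e.
Proof.
move=> acF e0; have [d d0 dP] := acF _ e0; exists d => // s t + + ts.
wlog : s t ts / s < t => [W|st] /andP[as_ sb] /andP[at_ tb].
  have [st|st|->] := ltgtP s t; last by rewrite subrr normr0.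
    by apply: W => //; apply/andP.
  by rewrite distrC; apply: W => //; [rewrite distrC|apply/andP|apply/andP].
have := dP 1%N (fun=> s) (fun=> t); rewrite !big_ord1; apply.
- by move=> _; rewrite as_ st.
- by move=> i j _ _ _; rewrite !ord1.
- by rewrite gtr0_norm ?subr_gt0// in ts.
Qed.

Lemma abs_continuous_within F : abs_continuous a b F -> {within `[a, b], continuous F}.
Proof.
move=> acF; apply/subspace_continuousP => x /= xab.
apply/cvgrPdist_lt => e e0; have [d d0 dP] := abs_continuous_dist acF e0.
apply/nbhs_ballP; exists d => // y xy yab; rewrite /= !in_itv/= in xab yab.
exact: dP.
Qed.

Lemma abs_continuous_measurable F : abs_continuous a b F -> measurable_fun `[a, b] F.
Proof.
by move=> /abs_continuous_within; apply: subspace_continuous_measurable_fun.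
Qed.

Lemma abs_continuous_bounded F : abs_continuous a b F ->
  exists M : R, forall x, a <= x <= b -> `|F x| <= M.
Proof.
move=> /abs_continuous_within cF.
have /compact_bounded[M [_ HM]] := continuous_compact cF (@segment_compact _ a b).
exists (M + 1) => x xab; apply: (HM (M + 1)); first by rewrite ltrDl.
by exists x => //=; rewrite in_itv.
Qed.


(* Away from an open set [U] of measure less than [d] (given by absolute continuity),
   [F] varies slowly near each point; the set of [c] up to which the variation of [F]
   is controlled by that of finitely many intervals in [U] has supremum [b]. *)
Lemma abs_continuous_deriv0 F : a < b -> abs_continuous a b F ->
  {ae mu, forall x, `[a, b]%classic x -> has_derivative_within `[a, b] F x 0} ->
  F b = F a.
Proof.
move=> ab acF [N [mN N0 NP]].
suff Fab e : 0 < e -> `|F b - F a| <= e * (b - a) + e.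
  apply/eqP; rewrite -subr_eq0 -normr_le0; apply/ler_addgt0Pr => e e0; rewrite add0r.
  have ba1 : 0 < b - a + 1 by rewrite addr_gt0// subr_gt0.
  apply: le_trans (Fab (e / (b - a + 1)) _) _; first by rewrite divr_gt0.
  by rewrite -[X in _ + X]mulr1 -mulrDr divfK// gt_eqF.
move=> e0; have [d d0 dP] := acF _ e0.
have [U [oU NU mU]] : exists U : set R, [/\ open U, N `<=` U & (mu U < d%:E)%E].
  have Nfin : (mu N < +oo)%E by rewrite N0.
  have [U [oU NU mUN]] := lebesgue_regularity_outer mN Nfin d0.
  exists U; split => //; rewrite -(setDUK NU) (le_lt_trans (measureU2 _ _ _))//.
    by apply: measurableD => //; exact: open_measurable.
  by rewrite [X in (X + _ < _)%E](_ : _ = 0%E) ?add0e.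
pose good c := exists n (s t : nat -> R),
  [/\ forall i, (i < n)%N -> [/\ a <= s i, s i < t i, t i <= c & `]s i, t i[ `<=` U],
      forall i j, (i < j)%N -> (j < n)%N -> t i <= s j &
      `|F c - F a| <= e * (c - a) + \sum_(i < n) `|F (t i) - F (s i)|].
(* Goodness crosses every point [x]. If [x] lies in the null set, []c, y[] is contained in [U] and
   joins the family; otherwise the zero derivative at [x] bounds the new increment by
   [e * (y - c)]. *)
have step x : a <= x <= b -> exists2 r, 0 < r & forall c y, a <= c <= x -> x - r < c ->
    good c -> x <= y <= b -> y < x + r -> good y.
  move=> xab; have [Nx|Nx] := pselect (N x).
    have /nbhs_ballP[r /= r0 rU] : nbhs x U.
      by apply: open_nbhs_nbhs; split=> //; exact: NU.
    exists r => // c y /andP[ac cx] xrc [n [s [t [st ts Fc]]]] /andP[xy yb] yxr.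
    have [cy|cy] := ltP c y; last first.
      have -> : y = c by apply/eqP; rewrite eq_le cy (le_trans cx xy).
      by exists n, s, t.
    exists n.+1, (fun i => if (i < n)%N then s i else c),
      (fun i => if (i < n)%N then t i else y); split.
    - move=> i; rewrite ltnS leq_eqVlt => /predU1P[->|ni].
        rewrite ltnn; split => // z /=; rewrite in_itv/= => /andP[cz zy].
        by apply: rU; rewrite /ball/= ltr_distl; lra.
      rewrite ni; have [? ? tc ?] := st _ ni; split => //.
      exact: le_trans tc (ltW cy).
    - move=> i j ij; rewrite ltnS leq_eqVlt => /predU1P[jn|jn].
        by rewrite jn ltnn -jn ij; rewrite jn in ij; have [] := st _ ij.
      by rewrite jn (ltn_trans ij jn) ts.
    - rewrite big_ord_recr/= ltnn.
      under eq_bigr do rewrite ltn_ord.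
      have -> : F y - F a = (F c - F a) + (F y - F c) by ring.
      apply: le_trans (ler_normD _ _) _; rewrite addrA lerD2r.
      by apply: le_trans Fc _; rewrite lerD2r ler_pM2l// lerD2r ltW.
  have dFx : has_derivative_within `[a, b] F x 0.
    apply: contrapT => nd; apply: Nx; apply: NP => /= h; apply: nd.
    by apply: h; rewrite in_itv.
  have [r r0 rF] := has_derivative_within_bound dFx e0.
  exists r => // c y /andP[ac cx] xrc [n [s [t [st ts Fc]]]] /andP[xy yb] yxr.
  exists n, s, t; split => //.
    move=> i ni; have [? ? tc ?] := st _ ni; split => //.
    exact: le_trans tc (le_trans cx xy).
  have /rF : `[a, b]%classic c by rewrite /= in_itv/= ac (le_trans cx)// (andP xab).2.
  have /rF : `[a, b]%classic y by rewrite /= in_itv/= yb (le_trans _ xy)// (andP xab).1.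
  rewrite ger0_norm ?subr_ge0// ltrBlDr addrC => /(_ yxr).
  rewrite mul0r subr0 => Fy.
  rewrite ler0_norm ?subr_le0// opprB ltrBlDl -ltrBlDr => /(_ xrc).
  rewrite mul0r subr0 => Fcx.
  have -> : F y - F a = (F c - F a) + ((F y - F x) - (F c - F x)) by ring.
  apply: le_trans (ler_normD _ _) _.
  have := ler_normB (F y - F x) (F c - F x); lra.
pose S := [set c | a <= c <= b /\ good c].
have Sa : S a.
  split; first by rewrite lexx ltW.
  by exists 0%N, (fun=> 0), (fun=> 0); split => //; rewrite big_ord0 !subrr normr0 mulr0 addr0.
have supS : has_sup S by split; [exists a|exists b => c [/andP[]]].
have Sab : a <= sup S <= b.
  apply/andP; split; first by apply: ub_le_sup => //; exact: supS.2.
  by apply: ge_sup; [exists a|move=> c [/andP[]]].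
have [r r0 rS] := step _ Sab.
have [c [/andP[ac cb] gc] rc] := sup_adherent r0 supS.
have cS : c <= sup S by apply: ub_le_sup; [exact: supS.2|split => //; apply/andP].
(* By [step] this point is good, so it cannot exceed the supremum; this forces [y = b]. *)
pose y := Num.min b (sup S + r / 2).
have Sy : sup S <= y <= b.
  by rewrite /y le_min ge_min lexx (andP Sab).2 lerDl divr_ge0// ltW.
have gy : good y.
  apply: (rS c) => //; first by rewrite ac.
  by rewrite gt_min; apply/orP; right; rewrite ltrD2l ltr_pdivrMr// ltr_pMr// ltr1n.
have yS : y <= sup S.
  apply: ub_le_sup; first exact: supS.2.
  by split => //; rewrite (andP Sy).2 andbT (le_trans (andP Sab).1)// (andP Sy).1.
have yb : y = b.
  move: yS; rewrite /y; case: (leP b (sup S + r / 2)) => // _.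
  by rewrite gerDl leNgt divr_gt0.
move: gy; rewrite yb => -[n [s [t [st ts Fb]]]].
apply: le_trans Fb _; rewrite lerD2l; apply/ltW.
have tI : trivIset setT (fun i : 'I_n => `]s i, t i[%classic).
  apply/trivIsetP => i j _ _; wlog : i j / (i < j)%N => [W ij|ij _].
    have [?|?|/ord_inj ij'] := ltngtP i j; first exact: W.
      by rewrite setIC; apply: W => //; rewrite eq_sym.
    by rewrite ij' eqxx in ij.
  rewrite -subset0 => z [] /=; rewrite !in_itv/= => /andP[_ zt] /andP[sz _].
  by have := ts _ _ ij (ltn_ord j); rewrite leNgt (lt_trans sz zt).
apply: (dP n (fun i => s i) (fun i => t i)) => //.
  by move=> i; have [-> -> ->] := st _ (ltn_ord i).
rewrite -lte_fin; apply: le_lt_trans mU.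
have -> : (\sum_(i < n) (t i - s i))%:E = (\sum_(i < n) mu `]s i, t i[%classic)%E.
  rewrite -sumEFin; apply: eq_bigr => i _; have [_ sit _ _] := st _ (ltn_ord i).
  by rewrite lebesgue_measure_itv/= lte_fin sit.
have /= <- := @measure_bigsetU_ord _ _ _ mu n xpredT (fun i => `]s i, t i[%classic)
  (fun i => measurable_itv _) tI.
apply: le_measure; rewrite ?inE//.
- by apply: bigsetU_measurable.
- exact: open_measurable.
- apply: (big_ind (fun A => A `<=` U)); first exact: sub0set.
    by move=> A B AU BU; rewrite subUset.
  by move=> i _; have [_ _ _] := st _ (ltn_ord i).
Qed.

End AbsolutelyContinuous.

(** Every integrand below belongs to this class on its interval. Unlike mere integrability it is
    stable under products, so it settles all integrability conditions uniformly. *)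
Definition bounded_measurable (R : realType) (a b : R) (u : R -> R) : Prop :=
  measurable_fun `[a, b] u /\ exists M : R, forall x, a <= x <= b -> `|u x| <= M.

Section BoundedMeasurable.
Variables (R : realType) (a b : R).
Local Notation mu := (@lebesgue_measure R).
Local Notation bm := (bounded_measurable a b).
Implicit Types u v : R -> R.

Lemma mu_itv_fin (c d : R) : (mu `[c, d] < +oo)%E.
Proof. by rewrite lebesgue_measure_itv/=; case: ifP; rewrite ?ltry// -EFinB ltry. Qed.

Lemma bounded_measurable_integrable u : bm u -> mu.-integrable `[a, b] (EFin \o u).
Proof.
move=> [mu_ [M uM]]; apply: measurable_bounded_integrable => //.
  exact: mu_itv_fin.
exists M; split; rewrite ?num_real// => N MN x /=; rewrite in_itv => xab.
by apply: le_trans (uM _ xab) (ltW MN).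
Qed.

Lemma bounded_measurableD u v : bm u -> bm v -> bm (u \+ v).
Proof.
move=> [mu_ [M uM]] [mv [N vN]]; split; first exact: measurable_funD.
exists (M + N) => x xab /=; apply: le_trans (ler_normD _ _) _.
by rewrite lerD ?uM ?vN.
Qed.

Lemma bounded_measurableM u v : bm u -> bm v -> bm (u \* v).
Proof.
move=> [mu_ [M uM]] [mv [N vN]]; split; first exact: measurable_funM.
exists (M * N) => x xab /=; rewrite normrM.
by rewrite ler_pM ?uM ?vN.
Qed.

Lemma bounded_measurable_norm u : bm u -> bm (fun x => `|u x|).
Proof.
move=> [mu_ [M uM]]; split; first exact: measurableT_comp.
by exists M => x /uM; rewrite normr_id.
Qed.

Lemma bounded_measurable_continuous u : continuous u -> bm u.
Proof.
move=> cu; split.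
  by apply: measurable_funTS; apply: continuous_measurable_fun.
have := continuous_compact (continuous_subspaceT cu) (@segment_compact _ a b).
move=> /compact_bounded[M [_ HM]]; exists (M + 1) => x xab.
by apply: (HM (M + 1)); rewrite ?ltrDl//; exists x => //=; rewrite in_itv.
Qed.

Lemma bounded_measurable_horner (p : {poly R}) : bm (horner p).
Proof. exact/bounded_measurable_continuous/continuous_horner. Qed.

Lemma bounded_measurable_cst k : bm (fun=> k).
Proof. by split; [exact: measurable_cst|exists `|k|]. Qed.

Lemma bounded_measurableB u v : bm u -> bm v -> bm (u \- v).
Proof.
move=> [mu_ [M uM]] [mv [N vN]]; split; first exact: measurable_funB.
exists (M + N) => x xab /=; apply: le_trans (ler_normB _ _) _.
by rewrite lerD ?uM ?vN.
Qed.

Lemma bounded_measurable_abs_continuous u : abs_continuous a b u -> bm u.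
Proof.
move=> acu; split; first exact: abs_continuous_measurable.
exact: abs_continuous_bounded.
Qed.

End BoundedMeasurable.

(** * Fundamental theorem and integration by parts for absolutely continuous functions *)

Section FundamentalTheorem.
Variable R : realType.
Local Notation mu := (@lebesgue_measure R).
Implicit Types (F G u : R -> R).

Lemma normr_Rintegral_le u M (c d : R) : c <= d -> bounded_measurable c d u ->
  (forall x, c <= x <= d -> `|u x| <= M) ->
  `|\int[mu]_(x in `[c, d]) u x| <= M * (d - c).
Proof.
move=> cd bu uM; have iu := bounded_measurable_integrable bu.
apply: le_trans (le_normr_Rintegral _ iu) _ => //.
apply: (@le_trans _ _ (\int[mu]_(x in `[c, d]) M)).
  apply: le_Rintegral => //.
    exact: integrable_norm.
  exact/bounded_measurable_integrable/bounded_measurable_cst.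
rewrite Rintegral_cst//= lebesgue_measure_itv/= lte_fin.
case: ltgtP cd => // <- _.
by rewrite /= subrr.
Qed.

(** Since [u] is bounded, its primitive [G] is Lipschitz, hence absolutely continuous; by Lebesgue
    differentiation [F - G] has derivative zero almost everywhere, so [abs_continuous_deriv0]
    applies. *)
Lemma abs_continuous_FTC2 F u (a b : R) : a < b -> abs_continuous a b F ->
  bounded_measurable a b u ->
  {ae mu, forall x, `[a, b]%classic x -> has_derivative_within `[a, b] F x (u x)} ->
  \int[mu]_(x in `[a, b]) u x = F b - F a.
Proof.
move=> ab acF bu dF; pose v := u \_ `[a, b].
have iu := bounded_measurable_integrable bu.
have iv : mu.-integrable setT (EFin \o v).
  rewrite /v -restrict_EFin; apply/integrable_restrict => //.
  by rewrite setTI.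
have ivA (A : set R) : measurable A -> mu.-integrable A (EFin \o v).
  by move=> mA; apply: integrableS iv.
pose G x := \int[mu]_(t in `]-oo, x]) v t.
have Gst s t : a <= s -> s <= t -> t <= b -> G t - G s = \int[mu]_(x in `[s, t]) u x.
  move=> as_ st tb; rewrite /G Rintegral_itvB//; last exact: ivA.
  rewrite Rintegral_itv_obnd_cbnd; last exact: ivA.
  apply: eq_Rintegral => x; rewrite inE/= in_itv/= => /andP[sx xt].
  rewrite /v patchE mem_set//= in_itv/=.
  by rewrite (le_trans as_ sx) (le_trans xt tb).
have dG : {ae mu, forall x, derivable G x 1 /\ derive1 G x = v x}.
  apply: FTC1Ny; first by move=> y; apply: ivA.
  exact: integrable_locally.
have acG : abs_continuous a b G.
  have [mu_ [M uM]] := bu.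
  apply: (@lipschitz_abs_continuous _ _ _ _ M) => s t as_ st tb.
  have stab x : s <= x <= t -> a <= x <= b.
    by move=> /andP[sx xt]; rewrite (le_trans as_ sx) (le_trans xt tb).
  rewrite (Gst _ _ as_ (ltW st) tb); apply: normr_Rintegral_le => //; first exact: ltW.
    split; last by exists M => x /stab; exact: uM.
    apply: measurable_funS mu_ => // x /=; rewrite !in_itv; exact: stab.
  by move=> x /stab; exact: uM.
have : (F \- G) b = (F \- G) a.
  apply: abs_continuous_deriv0 => //.
    apply: (@abs_continuous_dominated _ _ _ F G _ 1) => // s t _ _ _ /=.
    have -> : F t - G t - (F s - G s) = F t - F s - (G t - G s) by ring.
    by rewrite mul1r; exact: ler_normB.
  apply: filterS2 dF dG; first exact: (ae_filter_ringOfSetsType mu).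
  move=> x dF [dG Gv] xab.
  rewrite -(subrr (u x)); apply: has_derivative_withinB; first exact: dF.
  apply: is_derive_within; apply: DeriveDef => //.
  by rewrite -derive1E Gv /v patchE mem_set.
by rewrite -(Gst _ _ (lexx a) (ltW ab) (lexx b)) /= => E; lra.
Qed.

Lemma abs_continuous_by_parts F u (Q : {poly R}) (a b : R) : a < b ->
  abs_continuous a b F -> bounded_measurable a b u ->
  {ae mu, forall x, `[a, b]%classic x -> has_derivative_within `[a, b] F x (u x)} ->
  \int[mu]_(x in `[a, b]) (F x * Q^`().[x]) =
  F b * Q.[b] - F a * Q.[a] - \int[mu]_(x in `[a, b]) (u x * Q.[x]).
Proof.
move=> ab acF bu dF; have bF := bounded_measurable_abs_continuous acF.
have bQ := bounded_measurable_horner a b Q.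
have bQ' := bounded_measurable_horner a b Q^`().
have [_ [MF FM]] := bF; have [_ [MQ QM]] := bQ.
have [K _ QK] := poly_lipshitz Q a b.
apply/eqP; rewrite eq_sym subr_eq eq_sym addrC -RintegralD//; last 2 first.
- exact: (bounded_measurable_integrable (bounded_measurableM bu bQ)).
- exact: (bounded_measurable_integrable (bounded_measurableM bF bQ')).
apply/eqP; rewrite (@abs_continuous_FTC2 (F \* horner Q)) //.
- have acQ : abs_continuous a b (horner Q).
    apply: (@lipschitz_abs_continuous _ _ _ _ K) => s t as_ st tb.
    apply: le_trans (QK _ _ _ _) _; rewrite ?in_itv/= ?as_ ?tb ?andbT//.
    + exact: le_trans (ltW st) tb.
    + exact: le_trans as_ (ltW st).
    + by rewrite gtr0_norm// subr_gt0.
  apply: (@abs_continuous_dominated _ _ _ F (horner Q) _ (Num.max MF MQ)) => //.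
  move=> s t as_ st tb /=.
  have -> : F t * Q.[t] - F s * Q.[s] = (F t - F s) * Q.[t] + F s * (Q.[t] - Q.[s]).
    by ring.
  apply: le_trans (ler_normD _ _) _; rewrite !normrM mulrDr.
  rewrite [`|F t - F s| * _]mulrC lerD// ler_wpM2r// le_max.
    by rewrite QM ?orbT// tb (le_trans as_ (ltW st)).
  by rewrite FM// as_ (le_trans (ltW st) tb).
- apply: bounded_measurableD; exact: bounded_measurableM.
- apply: filterS dF; first exact: (ae_filter_ringOfSetsType mu).
  move=> x dF xab; apply: has_derivative_withinM; first exact: dF.
    exact: is_derive_within.
  exact: continuous_horner.
Qed.

Lemma Rintegral_deriv (Q : {poly R}) (a b : R) : a < b ->
  \int[mu]_(x in `[a, b]) Q^`().[x] = Q.[b] - Q.[a].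
Proof.
move=> ab; apply: (@Rintegral_FTC2 _ _ (horner Q)) => // x.
exact: continuous_horner.
Qed.

End FundamentalTheorem.

(** * Functions of bounded variation *)

Section BoundedVariation.
Variables (R : realType) (a b : R).
Local Notation mu := (@lebesgue_measure R).
Local Notation BV := (@bounded_variation R).
Local Notation TV := (@total_variation R).
Implicit Types (g : R -> R) (Q : {poly R}).

Lemma bounded_variation_dist g x y : BV a b g -> a <= x -> x <= y -> y <= b ->
  `|g y - g x| <= fine (TV a y g) - fine (TV a x g).
Proof.
move=> bg ax xy yb.
have fin z : a <= z -> z <= b -> TV a z g \is a fin_num.
  by move=> az zb; apply/bounded_variationP => //; apply: bounded_variationl zb bg.
have fxy : TV x y g \is a fin_num.
  apply/bounded_variationP => //.
  apply: (bounded_variationr ax xy); exact: bounded_variationl (le_trans ax xy) yb bg.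
have := total_variationD g ax xy => ->.
rewrite fineD ?fin ?(le_trans xy)// addrAC subrr add0r -lee_fin fineK//.
exact: total_variation_ge.
Qed.

Lemma bounded_variation_bounded g : a <= b -> BV a b g ->
  exists M : R, forall x, a <= x <= b -> `|g x| <= M.
Proof.
move=> ab bg; exists (`|g a| + fine (TV a b g)) => x /andP[ax xb].
have -> : g x = g a + (g x - g a) by rewrite addrC subrK.
apply: le_trans (ler_normD _ _) _; rewrite lerD2l.
apply: le_trans (bounded_variation_dist bg (lexx _) ax xb) _.
rewrite total_variationxx/= subr0.
rewrite -subr_ge0; apply: le_trans (bounded_variation_dist bg ax xb (lexx _)).
exact: normr_ge0.
Qed.

(** Jordan decomposition: the variation function, and the variation function minus [g], are both
    nondecreasing. Clamping the argument by [c] makes them monotone on the whole line. *)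
Lemma bounded_variation_measurable g : a <= b -> BV a b g ->
  bounded_measurable a b g.
Proof.
move=> ab bg; split; last exact: bounded_variation_bounded.
pose c x := Num.min b (Num.max a x).
have cab x : a <= c x <= b.
  by rewrite /c le_min ab le_max lexx /= ge_min lexx.
have cE x : a <= x <= b -> c x = x.
  by move=> /andP[ax xb]; rewrite /c max_r// min_r.
have cmono x y : x <= y -> c x <= c y.
  by move=> xy; rewrite /c le_min !ge_min lexx /= ge_max !le_max lexx xy !orbT.
have E : {in `[a, b], (fun x => (fine (TV a (c x) g)) - (fine (TV a (c x) g) - g (c x))) =1 g}.
  by move=> x; rewrite in_itv => xab; rewrite subKr cE.
have m1 : measurable_fun `[a, b] (fun x => fine (TV a (c x) g)).
  apply: nondecreasing_measurable => // x y xy.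
  rewrite -subr_ge0; apply: le_trans (normr_ge0 _)
    (bounded_variation_dist bg (andP (cab x)).1 (cmono _ _ xy) (andP (cab y)).2).
have m2 : measurable_fun `[a, b] (fun x => fine (TV a (c x) g) - g (c x)).
  apply: nondecreasing_measurable => // x y xy.
  have := bounded_variation_dist bg (andP (cab x)).1 (cmono _ _ xy) (andP (cab y)).2.
  have := ler_norm (g (c y) - g (c x)); lra.
apply: (eq_measurable_fun (fun x => (fine (TV a (c x) g)) - (fine (TV a (c x) g) - g (c x)))).
  by move=> x; rewrite inE => /E.
exact: measurable_funB.
Qed.

(** On a uniform partition of step [h], each cell contributes an error of at most [M + K h] times
    the variation of [g] on it, where [K] bounds [Q']. Boundary terms and variations telescope, and
    [K h] tends to [0]. *)
Lemma bounded_variation_by_parts_le g Q M : a < b -> BV a b g ->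
  Q.[a] = 0 -> Q.[b] = 0 -> (forall x, a <= x <= b -> `|Q.[x]| <= M) ->
  `|\int[mu]_(x in `[a, b]) (g x * Q^`().[x])| <= M * fine (TV a b g).
Proof.
move=> ab bg Qa Qb QM; pose T x := fine (TV a x g).
have gT x y : a <= x -> x <= y -> y <= b -> `|g y - g x| <= T y - T x.
  exact: bounded_variation_dist.
have bm_sub x y u : a <= x -> y <= b -> bounded_measurable a b u ->
    bounded_measurable x y u.
  move=> ax yb [mu_ [K uK]]; have xyab z : x <= z <= y -> a <= z <= b.
    by move=> /andP[xz zy]; rewrite (le_trans ax xz) (le_trans zy yb).
  split; last by exists K => z /xyab; exact: uK.
  by apply: measurable_funS mu_ => // z /=; rewrite !in_itv; exact: xyab.
have bmg := bounded_variation_measurable (ltW ab) bg.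
have bQ' := bounded_measurable_horner a b Q^`().
have bgQ := bounded_measurableM bmg bQ'.
have [_ [K QK]] := bQ'.
have K0 : 0 <= K by apply: le_trans (QK a _); rewrite ?normr_ge0// lexx ltW.
(* [g] is frozen at its right end value: the increment [g y - g x] is paired with [Q.[x]], which
   costs [M], and the deviation of [g] inside the cell with [Q'], which costs [K * (y - x)]. *)
have cell x y : a <= x -> x < y -> y <= b ->
    `|\int[mu]_(z in `[x, y]) (g z * Q^`().[z]) - g y * Q.[y] + g x * Q.[x]| <=
    (M + K * (y - x)) * (T y - T x).
  move=> ax xy yb.
  have -> : \int[mu]_(z in `[x, y]) (g z * Q^`().[z]) - g y * Q.[y] + g x * Q.[x] =
      \int[mu]_(z in `[x, y]) ((g z - g y) * Q^`().[z]) - (g y - g x) * Q.[x].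
    have -> : \int[mu]_(z in `[x, y]) ((g z - g y) * Q^`().[z]) =
       \int[mu]_(z in `[x, y]) (g z * Q^`().[z] - g y * Q^`().[z]).
      by apply: eq_Rintegral => z _; rewrite mulrBl.
    have bQ'xy := bounded_measurable_horner x y Q^`().
    rewrite RintegralB//; last 2 first.
    - by apply: bounded_measurable_integrable; exact: bm_sub bgQ.
    - apply: bounded_measurable_integrable; apply: bounded_measurableM bQ'xy.
      exact: bounded_measurable_cst.
    rewrite RintegralZl//; last exact: bounded_measurable_integrable.
    by rewrite Rintegral_deriv//; ring.
  apply: le_trans (ler_normB _ _) _; rewrite [leLHS]addrC [leRHS]mulrDl; apply: lerD.
    rewrite normrM mulrC; apply: ler_pM => //; last exact: gT (ltW xy) _.
    by apply: QM; rewrite ax (le_trans (ltW xy)).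
  rewrite mulrAC; apply: normr_Rintegral_le; first exact: ltW.
    apply: bounded_measurableM; last exact: bounded_measurable_horner.
    by apply: bounded_measurableB; [exact: bm_sub bmg|exact: bounded_measurable_cst].
  move=> z /andP[xz zy]; rewrite normrM mulrC ler_pM//.
    by apply: QK; rewrite (le_trans ax xz) (le_trans zy yb).
  rewrite distrC; apply: le_trans (gT _ _ _ zy yb) _; first exact: le_trans xz.
  have := gT _ _ ax xz (le_trans zy yb).
  by have := normr_ge0 (g z - g x); lra.
have sums n : (0 < n)%N -> `|\int[mu]_(x in `[a, b]) (g x * Q^`().[x])| <=
    (M + K * ((b - a) / n%:R)) * T b.
  move=> n0; pose h := (b - a) / n%:R.
  have n0R : (0 : R) < n%:R by rewrite ltr0n.
  have h0 : 0 < h by rewrite divr_gt0// subr_gt0.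
  pose x i := a + i%:R * h.
  have xn : x n = b by rewrite /x /h mulrCA divff ?gt_eqF// mulr1 addrC subrK.
  have xa i : a <= x i by rewrite lerDl mulr_ge0// ltW.
  have xS i : x i < x i.+1 by rewrite ltrD2l ltr_pM2r// ltr_nat.
  have xb i : (i <= n)%N -> x i <= b.
    by move=> i_n; rewrite -xn lerD2l ler_pM2r// ler_nat.
  have H i : (0 < i <= n)%N ->
      `|\int[mu]_(z in `[a, x i]) (g z * Q^`().[z]) - g (x i) * Q.[x i] + g a * Q.[a]| <=
      (M + K * h) * T (x i).
    have Ta : T a = 0 by rewrite /T total_variationxx.
    have x0 : x 0%N = a by rewrite /x mul0r addr0.
    have xSh j : x j.+1 - x j = h by rewrite /x -natr1; ring.
    elim: i => // -[_ n1|i IH /andP[_ i_n]].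
      have := cell a (x 1%N) (lexx a); rewrite -{1 2 5}x0 xSh x0 Ta subr0.
      by apply => //; [rewrite -{1}x0; apply: xS|apply: xb].
    have := cell (x i.+1) (x i.+2) (xa _) (xS _) (xb _ i_n); rewrite xSh.
    have {}IH := IH (ltnW i_n).
    have : \int[mu]_(z in `[a, x i.+2]) (g z * Q^`().[z]) =
      \int[mu]_(z in `[a, x i.+1]) (g z * Q^`().[z]) +
      \int[mu]_(z in `[x i.+1, x i.+2]) (g z * Q^`().[z]).
      have iaz : mu.-integrable `[a, x i.+2] (EFin \o (fun z => g z * Q^`().[z])).
        by apply: bounded_measurable_integrable; exact: bm_sub (lexx _) (xb _ i_n) bgQ.
      apply/eqP; rewrite addrC -subr_eq Rintegral_itvB//;
        [|by rewrite bnd_simp xa|by rewrite bnd_simp ltW].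
      apply/eqP; apply: Rintegral_itv_obnd_cbnd; apply: integrableS iaz => //.
      by apply: subset_itvr; rewrite bnd_simp xa.
    move=> ->; move: IH; set I1 := \int[mu]_(z in _) _; set I2 := \int[mu]_(z in _) _.
    move=> IH I2B.
    have -> : I1 + I2 - g (x i.+2) * Q.[x i.+2] + g a * Q.[a] =
      (I1 - g (x i.+1) * Q.[x i.+1] + g a * Q.[a]) +
      (I2 - g (x i.+2) * Q.[x i.+2] + g (x i.+1) * Q.[x i.+1]) by ring.
    apply: le_trans (ler_normD _ _) _; apply: le_trans (lerD IH I2B) _.
    by rewrite -mulrDr [X in _ * X]addrC subrK.
  have := H n; rewrite n0 leqnn => /(_ isT); rewrite xn Qa Qb !mulr0 subr0 addr0.
  by [].
apply/ler_addgt0Pr => e e0.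
have Tb0 : 0 <= T b.
  have := le_trans (normr_ge0 _) (gT a b (lexx _) (ltW ab) (lexx _)).
  by rewrite /T total_variationxx subr0.
have [n nP] : exists n : nat, K * (b - a) * T b / e < n.+1%:R.
  by exists (Num.truncn (K * (b - a) * T b / e : R)); exact: truncnS_gt.
apply: le_trans (sums n.+1 _) _ => //; rewrite mulrDl lerD2l.
move: nP; rewrite ltr_pdivrMr// => /ltW nP.
by rewrite mulrA mulrAC ler_pdivrMr// [leRHS]mulrC.
Qed.

End BoundedVariation.

(** * Legendre coefficients *)

Section LegendreOrthogonality.
Variable R : realType.
Local Notation mu := (@lebesgue_measure R).
Local Notation P := (legendre R).
Local Notation Om := (`[-1, 1]%classic : set R).
Local Notation bm := (bounded_measurable (-1) 1).
Implicit Types (p q : {poly R}) (f g : R -> R).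

Let ltN11 : (-1 : R) < 1. Proof. by lra. Qed.

Let intP (p : {poly R}) : mu.-integrable (Om) (EFin \o horner p).
Proof. exact/bounded_measurable_integrable/bounded_measurable_horner. Qed.

Let integral_horner p q :
  \int[mu]_(x in Om) (p.[x] * q.[x]) = \int[mu]_(x in Om) (p * q).[x].
Proof. by apply: eq_Rintegral => x _; rewrite hornerM. Qed.

(** Sturm-Liouville argument: [w] is the Wronskian weighted by [X^2 - 1]. Its derivative is the
    difference of the eigenvalues times [P j * P k], and it vanishes at both endpoints. *)
Lemma legendre_orthogonal j k : j != k ->
  \int[mu]_(x in Om) ((P j).[x] * (P k).[x]) = 0.
Proof.
move=> jk; rewrite integral_horner.
pose w := ('X^2 - 1) * ((P k)^`() * P j - (P j)^`() * P k) : {poly R}.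
have dw : w^`() = ((k * k.+1)%:R - (j * j.+1)%:R) *: (P j * P k).
  rewrite /w mulrBr !mulrA derivB !(derivM (_ * _)) !legendre_ode.
  by rewrite scalerBl !scaler_nat; ring.
have w1 : w.[1] - w.[-1] = 0.
  rewrite /w !hornerM [('X^2 - 1).[1]]hornerD [('X^2 - 1).[-1]]hornerD !hornerN.
  by rewrite !hornerXn !hornerC sqrrN expr1n subrr !mul0r subrr.
have := Rintegral_deriv w ltN11; rewrite w1 dw.
under eq_Rintegral do rewrite hornerZ.
rewrite RintegralZl//.
move/eqP; rewrite mulf_eq0 => /orP[|/eqP//].
rewrite subr_eq0 eqr_nat => /eqP E; exfalso; move/eqP: jk; apply; nia.
Qed.

Lemma legendre_span n q : (size q <= n)%N ->
  exists c : nat -> R, q = \sum_(k < n) c k *: P k.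
Proof.
elim: n q => [|n IH] q sq.
  by exists (fun=> 0); rewrite big_ord0; apply/eqP; rewrite -size_poly_leq0.
have lP : (P n)`_n != 0.
  have := lead_coef_eq0 (P n); rewrite /lead_coef size_legendre/= => ->.
  by rewrite -size_poly_eq0 size_legendre.
have [c cE] : exists c : nat -> R, q - (q`_n / (P n)`_n) *: P n = \sum_(k < n) c k *: P k.
  apply: IH; apply/leq_sizeP => j nj; rewrite coefB coefZ.
  have [->|jn] := eqVneq j n; first by rewrite divfK// subrr.
  have {}nj : (n < j)%N by rewrite ltn_neqAle eq_sym jn.
  rewrite [q`_j]nth_default ?(leq_trans sq)// [(P n)`_j]nth_default ?size_legendre//.
  by rewrite mulr0 subr0.
exists (fun k => if (k < n)%N then c k else q`_n / (P n)`_n).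
rewrite big_ord_recr/= ltnn; under eq_bigr do rewrite ltn_ord.
by rewrite -cE subrK.
Qed.

Lemma legendre_ortho_lt k q : (size q <= k)%N ->
  \int[mu]_(x in Om) ((P k).[x] * q.[x]) = 0.
Proof.
move=> /legendre_span[c ->]; rewrite integral_horner.
suff H n : (n <= k)%N -> \int[mu]_(x in Om) (P k * \sum_(i < n) c i *: P i).[x] = 0.
  exact: H.
elim: n => [|n IH] nk.
  under eq_Rintegral do rewrite big_ord0 mulr0 horner0.
  by rewrite Rintegral_cst// mul0r.
rewrite big_ord_recr/=; under eq_Rintegral do rewrite mulrDr hornerD.
rewrite RintegralD//; try exact: intP.
rewrite IH ?(ltnW nk)// add0r; under eq_Rintegral do rewrite -scalerAr hornerZ hornerM.
rewrite RintegralZl//; last first.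
  by under [X in EFin \o X]eq_fun do rewrite -hornerM; exact: intP.
by rewrite legendre_orthogonal ?mulr0// gtn_eqF.
Qed.

(** One factor is replaced by means of [deriv_legendreB]. After integration by parts the remaining
    integrals vanish by degree, and only the boundary term of [P k.+1 * P k.+2], equal to [2], is
    left. *)
Lemma legendre_norm k :
  \int[mu]_(x in Om) ((P k).[x] * (P k).[x]) = 2 / (2 * k%:R + 1).
Proof.
case: k => [|k].
  rewrite legendre0; under eq_Rintegral do rewrite !hornerC mulr1.
  rewrite Rintegral_cst//= lebesgue_measure_itv/= lte_fin ltN11 -EFinB/=.
  by rewrite mulr0 add0r; lra.
have k0 : (2 * k.+1%:R + 1 : R) != 0 by rewrite gt_eqF// ltr_wpDl// mulr_ge0.
apply: (mulfI k0); rewrite mulrCA divff// mulr1 -RintegralZl//; last first.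
  by under [X in EFin \o X]eq_fun do rewrite -hornerM; exact: intP.
have E x : (2 * k.+1%:R + 1) * ((P k.+1).[x] * (P k.+1).[x]) =
   (P k.+1 * P k.+2)^`().[x] - (P k.+2).[x] * (P k.+1)^`().[x] - (P k.+1).[x] * (P k)^`().[x].
  have := congr1 (horner^~ x) (deriv_legendreB R k).
  rewrite hornerMn hornerD hornerN derivM hornerD !hornerM => E.
  transitivity ((P k.+1).[x] * ((P k.+2)^`().[x] - (P k)^`().[x])); last by ring.
  by rewrite E -[_ *+ (2 * _).+1]mulr_natr -[(2 * k.+1).+1]addn1 natrD natrM; ring.
under eq_Rintegral do rewrite E.
have I1 : mu.-integrable (Om) (EFin \o (fun x => (P k.+2).[x] * (P k.+1)^`().[x])).
  by under [X in EFin \o X]eq_fun do rewrite -hornerM; exact: intP.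
have I2 : mu.-integrable (Om) (EFin \o (fun x => (P k.+1).[x] * (P k)^`().[x])).
  by under [X in EFin \o X]eq_fun do rewrite -hornerM; exact: intP.
rewrite RintegralB//; last first.
  by under [X in EFin \o X]eq_fun do rewrite -hornerM -hornerN -hornerD; exact: intP.
rewrite RintegralB//.
rewrite !legendre_ortho_lt ?subr0.
- rewrite Rintegral_deriv// !hornerM !legendre_at1 !legendre_atN1 -exprD.
  rewrite -signr_odd (_ : odd _ = true) ?expr1 ?mulr1 ?opprK//; lia.
- rewrite -ltnS; apply: leq_trans (lt_size_deriv _) _;
  by rewrite ?size_legendre// -size_poly_eq0 size_legendre.
- by rewrite -ltnS (leq_trans (lt_size_deriv _)) ?size_legendre//
    -?size_poly_eq0 ?size_legendre.
Qed.

Lemma legendre_coef_deriv f g k : abs_continuous (-1) 1 f -> bm g ->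
  {ae mu, forall x, Om x -> has_derivative_within Om f x (g x)} ->
  legendre_coef f k.+1 =
  (\int[mu]_(x in Om) (g x * (P k).[x]) - \int[mu]_(x in Om) (g x * (P k.+2).[x])) / 2.
Proof.
move=> acf bg dfg; rewrite /legendre_coef /Omega.
have := abs_continuous_by_parts (P k.+2 - P k) ltN11 acf bg dfg.
have bf := bounded_measurable_abs_continuous acf.
rewrite !hornerD !hornerN !legendreS2_sqr1 ?sqrrN ?expr1n// !subrr !mulr0 subr0 sub0r.
have E x : f x * (P k.+2 - P k)^`().[x] = (2 * k.+1).+1%:R * (f x * (P k.+1).[x]).
  by rewrite derivB deriv_legendreB hornerMn -mulr_natr; ring.
have E' x : g x * (P k.+2 - P k).[x] = g x * (P k.+2).[x] - g x * (P k).[x].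
  by rewrite hornerD hornerN mulrBr.
under eq_Rintegral do rewrite E; under [in X in _ = - X]eq_Rintegral do rewrite E'.
have I j : mu.-integrable Om (EFin \o (fun x => g x * (P j).[x])).
  apply: bounded_measurable_integrable; apply: bounded_measurableM bg _.
  exact: bounded_measurable_horner.
rewrite RintegralZl//; last first.
  apply: bounded_measurable_integrable; apply: bounded_measurableM bf _.
  exact: bounded_measurable_horner.
rewrite RintegralB// opprB => {}E; rewrite -E -[(2 * k.+1).+1]addn1 natrD natrM.
by field.
Qed.

Lemma legendre_coef_BV_le g k : bounded_variation (-1) 1 g ->
  `|legendre_coef g k.+1| <=
  2 * fine (total_variation (-1) 1 g) / Num.sqrt (2 * pi * k.+1%:R).
Proof.
move=> bg; have := @bounded_variation_by_parts_le _ _ _ g (P k.+2 - P k)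
  (4 / Num.sqrt (2 * pi * k.+1%:R)) ltN11 bg.
have bmg := bounded_variation_measurable (ltW ltN11) bg.
rewrite !hornerD !hornerN !legendreS2_sqr1 ?sqrrN ?expr1n// !subrr.
have Q x : -1 <= x <= 1 -> `|(P k.+2 - P k).[x]| <= 4 / Num.sqrt (2 * pi * k.+1%:R).
  by rewrite hornerD hornerN; apply: legendreB_bound.
move=> /(_ erefl erefl Q).
have E x : g x * (P k.+2 - P k)^`().[x] = (2 * k.+1).+1%:R * (g x * (P k.+1).[x]).
  by rewrite derivB deriv_legendreB hornerMn -mulr_natr; ring.
under eq_Rintegral do rewrite E.
rewrite RintegralZl//; last first.
  apply: bounded_measurable_integrable; apply: bounded_measurableM bmg _.
  exact: bounded_measurable_horner.
move=> H; rewrite /legendre_coef /Omega.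
have -> : k.+1%:R + 2^-1 = (2 * k.+1).+1%:R / 2 :> R.
  by rewrite -[(2 * k.+1).+1]addn1 natrD natrM; field.
rewrite mulrAC normrM [`|2^-1|]ger0_norm// ler_pdivrMr//.
apply: le_trans H _; rewrite le_eqVlt; apply/orP; left; apply/eqP.
by ring.
Qed.

(** The product of the [1 / (x - j + 1/2)] for [1 <= j <= m], with the index shifted to start at
    [0]. *)
Local Notation hprod m x := (\prod_(j < m) (x - j%:R - 2^-1)^-1).

(** The induction passes to the shifted sequence [D i.+1]. Coefficient [k.+1] becomes half a
    difference of inner products of [D 1] of indices [k] and [k.+2]; the bound decreases with the
    index, so both obey the bound at [k]. Dividing by [k + 1/2] supplies the factor [j = 0] of the
    product at [k.+1]. *)
Lemma legendre_coef_le m (D : nat -> R -> R) k :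
  (forall i, (i < m)%N -> {ae mu, forall x, Om x ->
     has_derivative_within Om (D i) x (D i.+1 x)}) ->
  (forall i, (i < m)%N -> abs_continuous (-1) 1 (D i)) ->
  bounded_variation (-1) 1 (D m) -> (m < k)%N ->
  `|legendre_coef (D 0%N) k| <=
  2 * fine (total_variation (-1) 1 (D m)) / Num.sqrt (2 * pi * (k - m)%:R) *
  hprod m k%:R.
Proof.
elim: m D k => [|m IH] D k dD acD bv mk.
  rewrite big_ord0 mulr1 subn0; case: k mk => // k _.
  exact: legendre_coef_BV_le.
case: k mk => // k; rewrite ltnS subSS => mk.
have bmD1 : bm (D 1%N).
  case: (m) acD bv => [_ bv|m' acD _].
    exact: (bounded_variation_measurable (ltW ltN11)).
  exact/bounded_measurable_abs_continuous/acD.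
have {}IH j := IH (fun i => D i.+1) j (fun i im => dD i.+1 im) (fun i im => acD i.+1 im) bv.
set V := fine _ in IH *.
have V0 : 0 <= V by apply/fine_ge0/total_variation_ge0/ltW.
rewrite (legendre_coef_deriv k (acD 0%N _) bmD1 (dD 0%N _))//.
have coefE j : \int[mu]_(x in Om) (D 1%N x * (P j).[x]) =
    legendre_coef (D 1%N) j / (j%:R + 2^-1).
  by rewrite /legendre_coef /Omega mulrAC divff ?mul1r// gt_eqF// ltr_wpDl.
have pos j (i : nat) : (i < j)%N -> 0 < j%:R - i%:R - 2^-1 :> R.
  move=> ij; have : i%:R + 1 <= j%:R :> R by rewrite natr1 ler_nat.
  lra.
have C j : (k <= j)%N -> `|legendre_coef (D 1%N) j / (j%:R + 2^-1)| <=
   2 * V / Num.sqrt (2 * pi * (k - m)%:R) * hprod m.+1 k.+1%:R.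
  move=> kj; rewrite normrM normfV [`|j%:R + _|]ger0_norm ?addr_ge0//.
  rewrite big_ord_recl/= [k.+1%:R - 0]subr0 mulrCA [leRHS]mulrC; apply: ler_pM => //.
    apply: le_trans (IH j (leq_trans mk kj)) _; apply: ler_pM => //.
    - by rewrite !mulr_ge0// invr_ge0 sqrtr_ge0.
    - apply: prodr_ge0 => i _; rewrite invr_ge0 ltW// pos//.
      by rewrite (leq_trans (ltn_ord i))// ltnW// (leq_trans mk).
    - rewrite ler_wpM2l ?mulr_ge0// lef_pV2 ?posrE ?sqrtr_gt0 ?mulr_gt0
        ?pi_gt0 ?ltr0n ?subn_gt0 ?(leq_trans mk)//.
      by rewrite ler_wsqrtr// ler_wpM2l ?mulr_ge0 ?pi_ge0// ler_nat leq_sub2r.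
    - apply: ler_prod => i _; have im : (i < k)%N by rewrite (ltn_trans (ltn_ord i)).
      have ij : (i < j)%N by rewrite (leq_trans im).
      have -> : k.+1%:R - (bump 0 i)%:R - 2^-1 = k%:R - i%:R - 2^-1 :> R.
        by rewrite /bump/= add1n -!natr1; ring.
      rewrite invr_ge0 ltW ?pos// lef_pV2 ?posrE ?pos//.
      by rewrite !lerD2r ler_nat.
  have k0 := ler0n R k; have kjR : k%:R <= j%:R :> R by rewrite ler_nat.
  by rewrite -[k.+1%:R]natr1 lef_pV2 ?posrE; lra.
rewrite !coefE normrM [`|2^-1|]ger0_norm// ler_pdivrMr//.
apply: le_trans (ler_normB _ _) _; rewrite mulrDr mulr1 lerD ?C//; lia.
Qed.

End LegendreOrthogonality.

(** * Density of polynomials *)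

Section Weierstrass.
Variable R : realType.
Implicit Types (h : R -> R) (phi psi : nat -> R).

Lemma uniformly_continuous_itv h (a b e : R) : continuous h -> 0 < e ->
  exists2 d, 0 < d & forall x y, a <= x <= b -> `|y - x| < d -> `|h y - h x| <= e.
Proof.
move=> ch e0.
have := @segment_compact R a b => /compact_near_coveringP.
move=> /(_ R (0^'+) (fun d x => forall y, `|y - x| < d -> `|h y - h x| <= e)).
case.
- move=> x _; have e20 : 0 < e / 2 by rewrite divr_gt0.
  have /cvgrPdist_le/(_ _ e20)/nbhs_ballP[d /= d0 dP] := ch x.
  have d20 : 0 < d / 2 by rewrite divr_gt0.
  exists (ball x (d / 2), [set r | r < d / 2]).
    by split => /=; [exact: nbhsx_ballx|exact: nbhs_right_lt].
  move=> [x' r] /= [xx' rd] y yx'.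
  have hx' : `|h x - h x'| <= e / 2.
    by apply: dP; rewrite /ball/=; apply: lt_le_trans xx' _; lra.
  have hy : `|h x - h y| <= e / 2.
    apply: dP; rewrite /ball/= in xx' *.
    have -> : x - y = (x - x') - (y - x') by ring.
    by apply: le_lt_trans (ler_normB _ _) _; lra.
  have -> : h y - h x' = (h x - h x') - (h x - h y) by ring.
  by apply: le_trans (ler_normB _ _) _; lra.
- move=> r /= r0 H; exists (r / 2); first by rewrite divr_gt0.
  move=> x y xab yx; apply: (H (r / 2)) => //; rewrite ?divr_gt0//.
  by rewrite /ball_/= sub0r normrN gtr0_norm ?divr_gt0//; lra.
Qed.

(* The Bernstein polynomial of [phi], i.e. the expectation of [phi] at a binomial
   variable, with the first trial singled out. *)
Fixpoint bernstein n phi : {poly R} :=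
  if n is n'.+1 then
    'X * bernstein n' (fun k => phi k.+1) + (1 - 'X) * bernstein n' phi
  else (phi 0%N)%:P.

Lemma bernstein_le n phi psi t : 0 <= t <= 1 ->
  (forall k, (k <= n)%N -> phi k <= psi k) ->
  (bernstein n phi).[t] <= (bernstein n psi).[t].
Proof.
move=> t01; elim: n phi psi => [|n IH] phi psi le_phi /=.
  by rewrite !hornerC le_phi.
rewrite !hornerD !hornerM hornerX hornerD hornerN hornerX hornerC.
case/andP: t01 => t0 t1; rewrite lerD// ler_wpM2l ?subr_ge0//.
  by apply: IH => k kn; exact: le_phi.
by apply: IH => k kn; apply: le_phi; exact: leqW.
Qed.

(** For a binomial variable, the mean of [(k - c)^2] is the variance plus the squared bias. The free
    center [c] absorbs the shift of [k] in the induction. *)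
Lemma bernstein_quadratic n (u v c t : R) :
  (bernstein n (fun k => u + v * (k%:R - c) ^+ 2)).[t] =
  u + v * (n%:R * t * (1 - t) + (n%:R * t - c) ^+ 2).
Proof.
elim: n c => [|n IH] c /=; first by rewrite hornerC; ring.
rewrite !hornerD !hornerM hornerX hornerD hornerN hornerX hornerC IH.
have -> : (fun k => u + v * (k.+1%:R - c) ^+ 2) = (fun k => u + v * (k%:R - (c - 1)) ^+ 2).
  by apply/funext => k; rewrite -natr1; ring.
by rewrite IH -natr1; ring.
Qed.

(** Uniform continuity and boundedness give the quadratic majorant [e / 2 + L (y - x)^2] of
    [|h y - h x|]. Bernstein operators are monotone and exact on quadratics, so the error is at most
    [e / 2] plus a variance term, itself at most [L / n <= e / 2]. *)
Lemma weierstrass h e : continuous h -> 0 < e ->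
  exists p : {poly R}, forall x, -1 <= x <= 1 -> `|h x - p.[x]| <= e.
Proof.
move=> ch e0; have e20 : 0 < e / 2 by rewrite divr_gt0.
have [d d0 hd] := uniformly_continuous_itv (-1) 1 ch e20.
have [_ [M hM]] := bounded_measurable_continuous (-1) 1 ch.
have M0 : 0 <= M by apply: le_trans (hM 0 _); rewrite ?normr_ge0//; lra.
pose L := 2 * M / d ^+ 2.
have L0 : 0 <= L by rewrite !mulr_ge0// invr_ge0 sqr_ge0.
have hL x y : -1 <= x <= 1 -> -1 <= y <= 1 -> `|h y - h x| <= e / 2 + L * (y - x) ^+ 2.
  move=> x1 y1; have [yx|yx] := ltP `|y - x| d.
    by apply: le_trans (hd _ _ x1 yx) _; rewrite lerDl mulr_ge0 ?sqr_ge0.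
  apply: (@le_trans _ _ (2 * M)).
    by apply: le_trans (ler_normB _ _) _; rewrite mulr_natl mulr2n lerD ?hM.
  rewrite ler_wpDl ?(ltW e20)// /L -mulrA ler_peMr ?mulr_ge0//.
  rewrite mulrC ler_pdivlMr ?exprn_gt0// mul1r -[leRHS]real_normK ?num_real//.
  by rewrite ler_sqr ?nnegrE// ltW.
pose n := (Num.truncn (2 * L / e : R)).+1.
have n0 : (0 : R) < n%:R by rewrite ltr0n.
have nL : L / n%:R <= e / 2.
  rewrite ler_pdivrMr// -ler_pdivrMl// invf_div.
  by have := truncnS_gt (2 * L / e : R); rewrite -/n; lra.
pose phi k : R := h (2 * (k%:R / n%:R) - 1).
exists (bernstein n phi \Po (2^-1 *: ('X + 1))) => x x1.
pose t := 2^-1 * (x + 1); rewrite horner_comp.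
have -> : (2^-1 *: ('X + 1)).[x] = t by rewrite hornerZ hornerD hornerX hornerC.
have t01 : 0 <= t <= 1 by rewrite /t; lra.
(* With [x = 2 t - 1], the node [2 k / n - 1] lies at distance [2 |k - n t| / n] from [x], whence
   the factor [4 / n^2]. *)
have phiP k : (k <= n)%N ->
    `|phi k - h x| <= e / 2 + 4 * L / n%:R ^+ 2 * (k%:R - n%:R * t) ^+ 2.
  move=> kn; have kn1 : ((0 : R) <= (k%:R / n%:R : R) <= (1 : R)).
    by rewrite divr_ge0 ?ler0n//= ler_pdivrMr// mul1r ler_nat.
  apply: le_trans (hL _ _ x1 _) _; first by lra.
  rewrite lerD2l le_eqVlt; apply/orP; left; apply/eqP.
  by rewrite /t; field; rewrite gt_eqF.
have tt : 4 * t * (1 - t) <= 1.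
  rewrite -subr_ge0 (_ : _ - _ = (2 * t - 1) ^+ 2) ?sqr_ge0//; ring.
have Bv : 4 * L / n%:R ^+ 2 * (n%:R * t * (1 - t) + (n%:R * t - n%:R * t) ^+ 2) <= e / 2.
  apply: le_trans nL; rewrite subrr expr0n addr0.
  have -> : 4 * L / n%:R ^+ 2 * (n%:R * t * (1 - t)) = L / n%:R * (4 * t * (1 - t)).
    by field; rewrite gt_eqF.
  by rewrite ler_piMr// divr_ge0// ltW.
have Bu : (bernstein n phi).[t] <= h x + e / 2 + e / 2.
  apply: le_trans (@bernstein_le n _ (fun k => h x + e / 2 +
    4 * L / n%:R ^+ 2 * (k%:R - n%:R * t) ^+ 2) _ t01 _) _.
    by move=> k kn; have := phiP k kn; rewrite ler_norml; lra.
  by rewrite bernstein_quadratic lerD2l.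
have Bl : h x - e / 2 - e / 2 <= (bernstein n phi).[t].
  apply: le_trans (@bernstein_le n (fun k => h x - e / 2 +
    - (4 * L / n%:R ^+ 2) * (k%:R - n%:R * t) ^+ 2) _ _ t01 _); last first.
    by move=> k kn; have := phiP k kn; rewrite ler_norml; lra.
  by rewrite bernstein_quadratic lerD2l mulNr lerN2.
by rewrite ler_norml; lra.
Qed.

End Weierstrass.

(** * Projections in L^2: density, orthogonality, Parseval *)

Section LegendreL2.
Variable R : realType.
Local Notation mu := (@lebesgue_measure R).
Local Notation P := (legendre R).
Local Notation Om := (`[-1, 1]%classic : set R).
Local Notation bm := (bounded_measurable (-1) 1).
Implicit Types (p q : {poly R}) (f g : R -> R).

Let ltN11 : (-1 : R) < 1. Proof. by lra. Qed.

Let int f : bm f -> mu.-integrable Om (EFin \o f).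
Proof. exact: bounded_measurable_integrable. Qed.

Let bmP p : bm (horner p). Proof. exact: bounded_measurable_horner. Qed.

(** Closeness in L^1 to a continuous [g] is upgraded to L^2 by clipping [g] to the range [[-M, M]]
    of [f]: then [|f - c|^2 <= 2 M |f - g|]. Weierstrass approximation of the clipped [c] finishes.
    The choices of [d] and of [e / 8] make each contribution [e / 2]. *)
Lemma polynomials_dense f e : bm f -> 0 < e ->
  exists p : {poly R}, \int[mu]_(x in Om) (f x - p.[x]) ^+ 2 <= e.
Proof.
move=> bf e0; have [_ [M0 fM0]] := bf.
pose M := `|M0| + 1; have M0' : 0 < M by rewrite ltr_wpDl.
have fM x : -1 <= x <= 1 -> `|f x| <= M.
  by move=> /fM0 /le_trans; apply; rewrite ler_wpDr// ler_norm.
pose d := e / (8 * M); have d0 : 0 < d by rewrite divr_gt0// mulr_gt0.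
have [g [cg ig fg]] : exists g : R -> R, [/\ continuous g,
    mu.-integrable Om (EFin \o g) & \int[mu]_(x in Om) `|f x - g x| <= d].
  have [g_ [cg ig /fine_cvgP[_ /cvgrPdist_le/(_ _ d0)[n _ /(_ n (leqnn n))]]]] :=
    approximation_continuous_integrable (measurable_itv `[(-1:R), 1])
      (mu_itv_fin (-1) 1) (int bf).
  move=> /=; rewrite sub0r normrN => gd; exists (g_ n); split => //.
  by apply: le_trans gd; rewrite ler_norm.
pose c x := Num.max (- M) (Num.min M (g x)).
have cc : continuous c.
  move=> x; apply: (@continuous_max _ _ (fun=> - M) (fun x => Num.min M (g x))).
    exact: cvg_cst.
  apply: (@continuous_min _ _ (fun=> M) g); first exact: cvg_cst.
  exact: cg.
have cM x : `|c x| <= M.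
  by rewrite /c ler_norml le_max lexx /= ge_max ge_min lexx /= andbT; lra.
have fc x : -1 <= x <= 1 -> `|f x - c x| <= `|f x - g x|.
  move=> /fM; rewrite /c ler_norml /Num.max /Num.min => /andP[l u].
  have := ler_norm (f x - g x); have := ler_norm (- (f x - g x)); rewrite normrN.
  by rewrite ler_norml; case: (ltP M (g x)) => ?; case: ltP => ? ? ?; lra.
have e4 : 0 < Num.sqrt (e / 8) by rewrite sqrtr_gt0 divr_gt0.
have [p pP] := weierstrass cc e4.
exists p.
have bc : bm c by exact: bounded_measurable_continuous.
have pw x : -1 <= x <= 1 -> (f x - p.[x]) ^+ 2 <= 4 * M * `|f x - g x| + e / 4.
  move=> x1; have h1 := fc _ x1; have h2 := pP _ x1; have h3 := fM _ x1; have h4 := cM x.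
  have h5 : `|c x - p.[x]| ^+ 2 <= e / 8.
    rewrite -[leRHS](@sqr_sqrtr _ (e / 8)) ?divr_ge0 ?(ltW e0)//.
    by rewrite ler_sqr ?nnegrE ?sqrtr_ge0.
  have h6 : `|f x - c x| <= 2 * M by apply: le_trans (ler_normB _ _) _; lra.
  have h7 : `|f x - c x| ^+ 2 <= 2 * M * `|f x - g x|.
    by rewrite expr2; apply: ler_pM.
  rewrite !real_normK ?num_real// in h5 h7.
  have -> : f x - p.[x] = (f x - c x) + (c x - p.[x]) by ring.
  have := sqr_ge0 ((f x - c x) - (c x - p.[x])); rewrite sqrrD sqrrB; lra.
have bfg : bm (fun x => `|f x - g x|).
  apply: (@bounded_measurable_norm _ _ _ (f \- g)).
  by apply: bounded_measurableB => //; exact: bounded_measurable_continuous.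
have bMfg : bm (fun x => 4 * M * `|f x - g x|).
  exact: bounded_measurableM (bounded_measurable_cst _ _ (4 * M)) bfg.
have be : bm (fun=> e / 4) by exact: bounded_measurable_cst.
apply: (@le_trans _ _ (\int[mu]_(x in Om) (4 * M * `|f x - g x| + e / 4))).
  apply: le_Rintegral => //.
  - have bfp := bounded_measurableB bf (bmP p).
    exact: int (bounded_measurableM bfp bfp).
  - exact: int (bounded_measurableD bMfg be).
rewrite RintegralD//; last 2 first.
- exact: int bMfg.
- exact: int be.
rewrite RintegralZl//; last exact: int bfg.
rewrite Rintegral_cst//= lebesgue_measure_itv/= lte_fin ltN11 -EFinB/=.
have : 4 * M * \int[mu]_(x in Om) `|f x - g x| <= 4 * M * d.
  by rewrite ler_wpM2l// mulr_ge0// ltW.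
have -> : 4 * M * d = e / 2 by rewrite /d; field; rewrite gt_eqF.
by move: (4 * M * _) => I ?; lra.
Qed.


Definition legendre_proj_poly f n : {poly R} := \sum_(k < n.+1) legendre_coef f k *: P k.
Local Notation proj := legendre_proj_poly.

Lemma legendre_projE f n x : legendre_proj f n x = (proj f n).[x].
Proof.
rewrite /legendre_proj /proj horner_sum.
by apply: eq_bigr => k _; rewrite [RHS]hornerZ.
Qed.

Lemma legendre_coefE f k :
  \int[mu]_(x in Om) (f x * (P k).[x]) = legendre_coef f k * (2 / (2 * k%:R + 1)).
Proof.
rewrite /legendre_coef /Omega; move: (\int[mu]_(x in _) _) => I.
have := ler0n R k; move: (k%:R) => x x0; field; rewrite gt_eqF//; lra.
Qed.

Let bmB_proj f n : bm f -> bm (fun x => f x - (proj f n).[x]).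
Proof. by move=> bf; exact: bounded_measurableB. Qed.

Let integrable_mul f g : bm f -> bm g -> mu.-integrable Om (EFin \o (fun x => f x * g x)).
Proof. by move=> bf bg; apply: int; exact: bounded_measurableM. Qed.

Lemma legendre_proj_ortho_legendre f n k : bm f -> (k <= n)%N ->
  \int[mu]_(x in Om) ((f x - (proj f n).[x]) * (P k).[x]) = 0.
Proof.
move=> bf kn; under eq_Rintegral do rewrite mulrBl.
rewrite RintegralB//; try exact: integrable_mul.
have H j : (j <= n.+1)%N ->
    \int[mu]_(x in Om) ((\sum_(i < j) legendre_coef f i *: P i).[x] * (P k).[x]) =
    (k < j)%:R * (legendre_coef f k * (2 / (2 * k%:R + 1))).
  elim: j => [|j IH] jn.
    rewrite mul0r; under eq_Rintegral do rewrite big_ord0 horner0 mul0r.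
    by rewrite Rintegral_cst// mul0r.
  under eq_Rintegral do rewrite big_ord_recr/= hornerD hornerZ mulrDl -mulrA.
  rewrite RintegralD//; last 2 first.
  - exact: integrable_mul.
  - apply: int; apply: bounded_measurableM; first exact: bounded_measurable_cst.
    exact: bounded_measurableM.
  rewrite RintegralZl//; last exact: integrable_mul.
  rewrite (IH (ltnW jn)) ltnS [in RHS]leq_eqVlt.
  have [->|kj] := eqVneq k j.
    by rewrite ltnn mul0r add0r mul1r legendre_norm.
  by rewrite legendre_orthogonal 1?eq_sym// mulr0 addr0.
by rewrite H// ltnS kn mul1r legendre_coefE subrr.
Qed.

Lemma legendre_proj_ortho f n q : bm f -> (size q <= n.+1)%N ->
  \int[mu]_(x in Om) ((f x - (proj f n).[x]) * q.[x]) = 0.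
Proof.
move=> bf /legendre_span[c ->].
suff H j : (j <= n.+1)%N -> \int[mu]_(x in Om)
    ((f x - (proj f n).[x]) * (\sum_(i < j) c i *: P i).[x]) = 0 by exact: H.
elim: j => [|j IH] jn.
  under eq_Rintegral do rewrite big_ord0 horner0 mulr0.
  by rewrite Rintegral_cst// mul0r.
under eq_Rintegral do rewrite big_ord_recr/= hornerD hornerZ mulrDr mulrCA.
have bfp := bmB_proj n bf.
rewrite RintegralD//; last 2 first.
- exact: integrable_mul.
- apply: int; apply: bounded_measurableM; first exact: bounded_measurable_cst.
  exact: bounded_measurableM.
rewrite RintegralZl//; last exact: integrable_mul.
by rewrite (IH (ltnW jn)) legendre_proj_ortho_legendre// mulr0 addr0.
Qed.

Lemma size_legendre_proj f n : (size (proj f n) <= n.+1)%N.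
Proof.
apply: (big_ind (fun p : {poly R} => (size p <= n.+1)%N)) => [|p q sp sq|i _].
- by rewrite size_poly0.
- by rewrite (leq_trans (size_polyD _ _))// geq_max sp.
- by rewrite (leq_trans (size_scale_leq _ _))// size_legendre.
Qed.

(** Used twice: with [q] the previous projection it gives the Parseval increment, and with [q] a
    dense approximant the optimality of the projection. *)
Lemma legendre_pythagoras f n q : bm f -> (size q <= n.+1)%N ->
  \int[mu]_(x in Om) (f x - q.[x]) ^+ 2 =
  \int[mu]_(x in Om) (f x - (proj f n).[x]) ^+ 2 +
  \int[mu]_(x in Om) (proj f n - q).[x] ^+ 2.
Proof.
move=> bf sq; have bfp := bmB_proj n bf; pose r := proj f n - q.
have sr : (size (2 *: r) <= n.+1)%N.
  rewrite (leq_trans (size_scale_leq _ _))// (leq_trans (size_polyD _ _))//.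
  by rewrite size_polyN geq_max size_legendre_proj.
have E x : (f x - q.[x]) ^+ 2 = (f x - (proj f n).[x]) ^+ 2 + r.[x] ^+ 2 +
    (f x - (proj f n).[x]) * (2 *: r).[x].
  by rewrite hornerZ /r hornerD hornerN; ring.
under eq_Rintegral do rewrite E.
have b1 := bounded_measurableM bfp bfp; have b2 := bounded_measurableM (bmP r) (bmP r).
rewrite RintegralD//; last 2 first.
- exact: int (bounded_measurableD b1 b2).
- exact: integrable_mul.
rewrite legendre_proj_ortho// addr0 RintegralD//; [exact: int b1|exact: int b2].
Qed.

Local Notation err f n := (\int[mu]_(x in Om) (f x - (proj f n).[x]) ^+ 2).

Lemma legendre_errS f n : bm f ->
  err f n = err f n.+1 + legendre_coef f n.+1 ^+ 2 / (n.+1%:R + 2^-1).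
Proof.
move=> bf; rewrite (@legendre_pythagoras _ n.+1 (proj f n))//; last first.
  exact: leqW (size_legendre_proj _ _).
congr (_ + _); have E x : (proj f n.+1 - proj f n).[x] ^+ 2 =
    legendre_coef f n.+1 ^+ 2 * ((P n.+1).[x] * (P n.+1).[x]).
  by rewrite /proj big_ord_recr/= [X in X - _]addrC addrK hornerZ; ring.
under eq_Rintegral do rewrite E.
rewrite RintegralZl//; last exact: integrable_mul.
rewrite legendre_norm; congr (_ * _).
have := ler0n R n.+1; move: (n.+1%:R) => x x0; field; rewrite gt_eqF//; lra.
Qed.

Lemma legendre_err_small f n0 e : bm f -> 0 < e -> exists2 n, (n0 <= n)%N & err f n <= e.
Proof.
move=> bf e0; have [p pe] := polynomials_dense bf e0.
exists (maxn n0 (size p)); first exact: leq_maxl.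
apply: le_trans pe; rewrite (legendre_pythagoras bf (_ : size p <= (maxn n0 (size p)).+1)%N).
  by rewrite lerDl; apply: Rintegral_ge0 => x _; exact: sqr_ge0.
exact/leqW/leq_maxr.
Qed.

(* [err f k - T k] is nondecreasing in [k], with a nonpositive limit. *)
Lemma legendre_err_le f (T : nat -> R) n : bm f -> (forall k, (n <= k)%N -> 0 <= T k) ->
  (forall k, (n <= k)%N -> legendre_coef f k.+1 ^+ 2 / (k.+1%:R + 2^-1) <= T k - T k.+1) ->
  err f n <= T n.
Proof.
move=> bf T0 cT; have H k : err f n - T n <= err f (n + k)%N - T (n + k)%N.
  elim: k => [|k IH]; first by rewrite addn0.
  apply: le_trans IH _; rewrite addnS (legendre_errS _ bf).
  by have := cT (n + k)%N (leq_addr _ _); lra.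
apply/ler_addgt0Pr => e e0; have [N nN Ne] := legendre_err_small n bf e0.
have := H (N - n)%N; rewrite subnKC// => {}H.
by have := T0 N nN; lra.
Qed.

End LegendreL2.

(** * The projection error *)

Section Norms.
Variable R : realType.
Local Notation mu := (@lebesgue_measure R).
Local Notation P := (legendre R).
Local Notation Om := (`[-1, 1]%classic : set R).
Local Notation bm := (bounded_measurable (-1) 1).
Implicit Types (f g : R -> R).

Lemma LpOmega_norm2_le g B : bm g -> 0 <= B ->
  \int[mu]_(x in Om) (g x) ^+ 2 <= B ^+ 2 -> (LpOmega_norm 2%:E g <= B%:E)%E.
Proof.
move=> bg B0 gB; rewrite /LpOmega_norm unlock.
have -> : (\int[mu]_x (`|(EFin \o (g \_ (Omega R))) x| `^ 2))%E =
    (\int[mu]_(x in Om) (g x) ^+ 2)%:E.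
  have igg : mu.-integrable Om (EFin \o (fun x => g x ^+ 2)).
    exact: bounded_measurable_integrable (bounded_measurableM bg bg).
  rewrite /Rintegral fineK; last exact: integrable_fin_num.
  rewrite [RHS]integral_mkcond; apply: eq_integral => x _ /=.
  rewrite /Omega !patchE; case: ifPn => _.
    by rewrite powR_mulrn// real_normK ?num_real.
  by rewrite normr0 powR0.
rewrite poweR_EFin powR12_sqrt; last by apply: Rintegral_ge0 => x _; exact: sqr_ge0.
by rewrite lee_fin -[leRHS](ger0_norm B0) -sqrtr_sqr ler_wsqrtr.
Qed.

(** Pointwise convergence to [f] is replaced by a Chebyshev argument. Where [|f - f_n|] exceeds
    [U n + e], every later [|f - f_N|] exceeds [e], because [|f_N - f_n| <= U n - U N]. So [e^2]
    times the measure of that set is below L^2 errors that become arbitrarily small. *)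
Lemma LpOmega_normy_le f (U : nat -> R) n : bm f ->
  (forall k, (n <= k)%N -> 0 <= U k) ->
  (forall k, (n <= k)%N -> `|legendre_coef f k.+1| <= U k - U k.+1) ->
  (LpOmega_norm +oo (fun x => f x - legendre_proj f n x)%R <= (U n)%:E)%E.
Proof.
move=> bf U0 cU; have Un0 := U0 n (leqnn n).
have projU N x : (n <= N)%N -> -1 <= x <= 1 ->
    `|legendre_proj f N x - legendre_proj f n x| <= U n - U N.
  move=> nN x1; rewrite -(subnKC nN); elim: (N - n)%N => [|k IH].
    by rewrite addn0 !subrr normr0.
  rewrite addnS; have := cU (n + k)%N (leq_addr _ _).
  have -> : legendre_proj f (n + k).+1 x - legendre_proj f n x =
     (legendre_proj f (n + k) x - legendre_proj f n x) +
     legendre_coef f (n + k).+1 * (P (n + k).+1).[x].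
    by rewrite {1}/legendre_proj big_ord_recr/= addrAC.
  move=> c1; apply: le_trans (ler_normD _ _) _; rewrite normrM.
  have := ler_wpM2l (normr_ge0 (legendre_coef f (n + k).+1)) (legendre_le1 (n + k).+1 x1).
  by rewrite mulr1; lra.
have ae_le e : 0 < e -> {ae mu, forall x, Om x -> `|f x - legendre_proj f n x| <= U n + e}.
  move=> e0; pose A := [set x | Om x /\ U n + e < `|f x - legendre_proj f n x|].
  have bfn : bm (fun x => `|f x - legendre_proj f n x|).
    apply: (@bounded_measurable_norm _ _ _ (fun x => f x - legendre_proj f n x)).
    under eq_fun do rewrite legendre_projE.
    exact: bounded_measurableB bf (bounded_measurable_horner _ _ _).
  have mA : measurable A.
    have := bfn.1 (measurable_itv _) `]U n + e, +oo[%classic (measurable_itv _).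
    rewrite (_ : _ `&` _ = A)//; apply/seteqP.
    by split => x [Ox]; rewrite /= in_itv/= ?andbT => Ux;
      split => //=; rewrite in_itv/= ?andbT.
  have A0 : mu A = 0%E.
    have Afin : mu A \is a fin_num.
      rewrite ge0_fin_numE//; apply: le_lt_trans (mu_itv_fin (-1) 1).
      by apply: le_measure; rewrite ?inE// => x [].
    have bA : bm (\1_A).
      split; first exact: measurable_indic.
      by exists 1 => x _; rewrite indicE; case: (_ \in _); rewrite ?normr1 ?normr0.
    have be : bm (fun=> e ^+ 2) by exact: bounded_measurable_cst.
    have H d : 0 < d -> e ^+ 2 * fine (mu A) <= d.
      move=> d0; have [N nN] := legendre_err_small n bf d0; apply: le_trans.
      have -> : e ^+ 2 * fine (mu A) = \int[mu]_(x in Om) (e ^+ 2 * \1_A x).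
        rewrite RintegralZl//; last exact: bounded_measurable_integrable.
        congr (_ * _); rewrite /Rintegral integral_indic// setIidl//.
        by move=> x [].
      have bfN : bm (fun x => f x - (legendre_proj_poly f N).[x]).
        exact: bounded_measurableB bf (bounded_measurable_horner _ _ _).
      apply: le_Rintegral => //.
      - exact: bounded_measurable_integrable (bounded_measurableM be bA).
      - exact: bounded_measurable_integrable (bounded_measurableM bfN bfN).
      - move=> x Omx; rewrite indicE; case: (boolP (x \in A)) => [|_]; last first.
          by rewrite mulr0 sqr_ge0.
        rewrite inE mulr1 => -[_ fx].
        rewrite -[leRHS]real_normK ?num_real// ler_sqr ?nnegrE ?(ltW e0)//.
        rewrite /= in_itv/= in Omx; have := projU N x nN Omx; rewrite -legendre_projE.
        have E : f x - legendre_proj f n x = (f x - legendre_proj f N x) +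
          (legendre_proj f N x - legendre_proj f n x) by ring.
        have := ler_normD (f x - legendre_proj f N x)
          (legendre_proj f N x - legendre_proj f n x).
        by rewrite -E; have := U0 N nN; lra.
    rewrite -[mu A]fineK//; congr (_%:E); apply/eqP; rewrite eq_le fine_ge0// andbT.
    have e20 : 0 < e ^+ 2 by rewrite exprn_gt0.
    by rewrite -(ler_pM2l e20) mulr0; apply/ler_addgt0Pr => d d0; rewrite add0r H.
  exists A; split => // x /=; rewrite not_implyE => -[Omx /negP].
  by rewrite -ltNge => ?; split.
rewrite /LpOmega_norm unlock; case: ifPn => // _.
apply/lee_addgt0Pr => e e0; apply/ess_supP.
have := ae_le e e0; apply: filterS; first exact: (ae_filter_ringOfSetsType mu).
move=> x fx /=; rewrite lee_fin patchE; case: ifPn => [|_].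
  by rewrite inE => /fx.
by rewrite normr0 addr_ge0// ltW.
Qed.

End Norms.

(** * Telescoping comparisons for the tails *)

Section Sums.
Variable R : realType.

(** The tangent inequality for the convex function [x^-p]. With [a = 1 / x] and [b = 1 / (x - 1)],
    the induction rests on [b - a = a b]. *)
Lemma bernoulli_pow_diff (x : R) p : 1 < x ->
  p%:R / x ^+ p.+1 <= (x - 1) ^- p - x ^- p.
Proof.
move=> x1; have x0 : 0 < x by lra.
have y0 : 0 < x - 1 by lra.
rewrite -!exprVn; set a := x^-1; set b := (x - 1)^-1.
have a0 : 0 < a by rewrite invr_gt0.
have ab : a <= b by rewrite lef_pV2 ?posrE//; lra.
have baE : b - a = a * b by rewrite /a /b; field; rewrite !gt_eqF.
elim: p => [|p IH]; first by rewrite !expr0 mul0r subrr.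
rewrite -natr1 mulrDl mul1r.
have -> : b ^+ p.+1 - a ^+ p.+1 = b * (b ^+ p - a ^+ p) + a ^+ p * (b - a).
  by rewrite !exprS; ring.
apply: lerD; last by rewrite baE !exprSr -mulrA ler_pM2l ?exprn_gt0// ler_pM2l.
rewrite exprS mulrCA; apply: ler_pM => //; first exact: ltW.
by rewrite mulr_ge0// exprn_ge0// ltW.
Qed.

Local Notation hprod m x := (\prod_(j < m) (x - j%:R - 2^-1)^-1).

Lemma hprod_gt0 m (x : R) : m%:R <= x -> 0 < hprod m x.
Proof.
move=> mx; apply: prodr_gt0 => j _; rewrite invr_gt0.
have : (j.+1)%:R <= m%:R :> R by rewrite ler_nat.
rewrite -natr1; lra.
Qed.

Lemma hprod_le m (x : R) : m%:R < x -> hprod m x <= (x - m%:R) ^- m.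
Proof.
move=> mx; have -> : (x - m%:R) ^- m = \prod_(j < m) (x - m%:R)^-1.
  by rewrite prodr_const card_ord exprVn.
apply: ler_prod => j _.
have : (j.+1)%:R <= m%:R :> R by rewrite ler_nat.
rewrite -[j.+1%:R]natr1 => jm; have jx : 0 < x - j%:R - 2^-1 by lra.
by rewrite invr_ge0 (ltW jx) lef_pV2 ?posrE//; lra.
Qed.

(** Both products on the right are [hprod m.+1 x] with one end factor removed, the first or the
    last, and these two factors differ by [m]. Hence the denominator [m - 1] in the uniform
    bound. *)
Lemma hprod_telescope m (x : R) : m.+1%:R < x ->
  m%:R * hprod m.+1 x = hprod m (x - 1) - hprod m x.
Proof.
move=> mx; rewrite -natr1 in mx; have m0 := ler0n R m.
have E1 : hprod m (x - 1) = (x - 2^-1) * hprod m.+1 x.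
  rewrite [in RHS]big_ord_recl/= subr0 mulrA divff ?mul1r; last by rewrite gt_eqF//; lra.
  apply: eq_bigr => j _; congr (_ ^-1); rewrite /bump/= natrD; ring.
have E2 : hprod m x = (x - m%:R - 2^-1) * hprod m.+1 x.
  rewrite [in RHS]big_ord_recr/= mulrCA divff ?mulr1//.
  by rewrite gt_eqF//; lra.
by rewrite E1 E2; ring.
Qed.

(** For [m = 1], where [hprod_telescope] yields only [0]. With [s] and [t] the two roots,
    [1/t - 1/s = 1 / (s t (s + t))] and [t (s + t) <= 2 x]. *)
Lemma inv_sqrt_telescope (x : R) : 1 < x ->
  (Num.sqrt x)^-1 / (x + 2^-1) <= 2 * ((Num.sqrt (x - 1))^-1 - (Num.sqrt x)^-1).
Proof.
move=> x1; set s := Num.sqrt x; set t := Num.sqrt (x - 1).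
have s0 : 0 < s by rewrite sqrtr_gt0; lra.
have t0 : 0 < t by rewrite sqrtr_gt0; lra.
have ss : s ^+ 2 = x by rewrite sqr_sqrtr//; lra.
have tt : t ^+ 2 = x - 1 by rewrite sqr_sqrtr//; lra.
have ts : t <= s by rewrite ler_wsqrtr//; lra.
have -> : 2 * (t^-1 - s^-1) = 2 * (s ^+ 2 - t ^+ 2) / (s * t * (s + t)).
  by field; rewrite !gt_eqF// addr_gt0.
rewrite ss tt (_ : x - (x - 1) = 1); last by ring.
have x2 : 0 < x + 2^-1 by lra.
have ts2 : t * s <= s * s by rewrite ler_pM2r.
have tt2 : t * t <= s * s by apply: ler_pM => //; exact: ltW.
rewrite mulr1 -invfM -[leLHS]mul1r ler_pdivrMr ?mulr_gt0// mulrAC.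
rewrite ler_pdivlMr ?mulr_gt0 ?addr_gt0// mul1r.
have -> : 2 * (s * (x + 2^-1)) = s * (2 * x + 1) by field.
by rewrite -[leLHS]mulrA ler_pM2l// mulrDr; rewrite -ss expr2; lra.
Qed.

End Sums.

Lemma eq_LpOmega_norm (R : realType) p (g h : R -> R) :
  (forall x, Omega R x -> g x = h x) -> LpOmega_norm p g = LpOmega_norm p h.
Proof.
move=> gh; rewrite /LpOmega_norm; congr Lnorm; apply/funext => x /=; congr EFin.
by rewrite !patchE; case: ifPn => //; rewrite inE; exact: gh.
Qed.

(* [D k] is the derivative f^(k) for k < m, and [D m] is the function of bounded
   variation which coincides with f^(m) (almost everywhere if m >= 1). *)
Theorem theorem3p5 (R : realType) (m : nat) (f : R -> R) (D : nat -> R -> R)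
  (hD0 : forall x, Omega R x -> D 0%N x = f x)
  (hD : forall k, (k.+1 < m)%N -> forall x, Omega R x ->
     has_derivative_within (Omega R) (D k) x (D k.+1 x))
  (hDm : (0 < m)%N -> {ae @lebesgue_measure R, forall x, Omega R x ->
     has_derivative_within (Omega R) (D m.-1) x (D m x)})
  (hAC : forall k, (k < m)%N -> abs_continuous (-1) 1 (D k))
  (hBV : bounded_variation (-1) 1 (D m)) :
  let V : R := fine (total_variation (-1) 1 (D m)) in
  (forall n : nat, (m + 1 <= n)%N ->
     (LpOmega_norm 2%:E (fun x => f x - legendre_proj f n x)%R
      <= (V / (Num.sqrt (pi * (m%:R + 1 / 2)) *
               (n%:R - m%:R) `^ (m%:R + 1 / 2)))%:E)%E)
  /\
  (forall n : nat, (1 <= m)%N -> (m + 1 <= n)%N ->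
     (LpOmega_norm +oo (fun x => f x - legendre_proj f n x)%R
      <= (if m == 1%N then
            4 * V / Num.sqrt (2 * pi * (n%:R - 1))
          else
            (2 * V / (m%:R - 1)) / Num.sqrt (2 * pi * (n%:R + 1 - m%:R)) *
            \prod_(1 <= k < m) (1 / (n%:R - k%:R + 1 / 2)))%:E)%E).
Proof.
Proof.
move=> V.
have dD i : (i < m)%N -> {ae @lebesgue_measure R, forall x, `[-1, 1]%classic x ->
    has_derivative_within `[-1, 1] (D i) x (D i.+1 x)}.
  rewrite leq_eqVlt => /predU1P[im|im]; last by apply: aeW => x Ox; exact: hD.
  by move: hDm; rewrite -im => /(_ isT).
have coef_le k : (m < k)%N -> `|legendre_coef (D 0%N) k| <=
    2 * V / Num.sqrt (2 * pi * (k%:R - m%:R)) *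
    \prod_(j < m) (k%:R - j%:R - 2^-1)^-1.
  by move=> mk; rewrite -natrB ?(ltnW mk)//; exact: legendre_coef_le.
have N11 : (-1 : R) < 1 by lra.
have bD : bounded_measurable (-1) 1 (D 0%N).
  have [m0|m0] := posnP m; last exact/bounded_measurable_abs_continuous/hAC.
  by apply: (bounded_variation_measurable (ltW N11)); rewrite -m0.
have V0 : 0 <= V by apply/fine_ge0/total_variation_ge0/ltW.
have pi0 := pi_gt0 R.
(* [f] and [D 0] need only agree on [Omega]; the norm and the coefficients do not see anything
   else. *)
have normE p n : LpOmega_norm p (fun x => f x - legendre_proj f n x) =
    LpOmega_norm p (fun x => D 0%N x - legendre_proj (D 0%N) n x).
  apply: eq_LpOmega_norm => x Ox; rewrite hD0//; congr (_ - _).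
  apply: eq_bigr => k _; rewrite /legendre_coef; congr (_ * _ * _).
  by apply: eq_Rintegral => y; rewrite inE => Oy; rewrite hD0.
split=> n.
- rewrite addn1 => mn; rewrite normE.
  have mnR : m%:R + 1 <= n%:R :> R by rewrite natr1 ler_nat.
  have B0 : 0 <= V / (Num.sqrt (pi * (m%:R + 1 / 2)) * (n%:R - m%:R) `^ (m%:R + 1 / 2)).
    by rewrite divr_ge0// mulr_ge0 ?sqrtr_ge0 ?powR_ge0.
  have bDn : bounded_measurable (-1) 1 (fun x => D 0%N x - legendre_proj (D 0%N) n x).
    under eq_fun do rewrite legendre_projE.
    exact: bounded_measurableB bD (bounded_measurable_horner _ _ _).
  apply: LpOmega_norm2_le => //.
  under eq_Rintegral do rewrite legendre_projE.
  (* With [x = k + 1 - m], [coef_le] and [hprod_le] bound the squared coefficient by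
     [(2 V^2 / pi) x^-(2m+1)]. Dividing by [k + 3/2 >= x] gives [C (2m+1) / x^(2m+2)], the left side
     of [bernoulli_pow_diff] for [p = 2m+1]. *)
  pose C := V ^+ 2 / (pi * (m%:R + 2^-1)).
  have C0 : 0 <= C by rewrite divr_ge0 ?sqr_ge0// mulr_ge0 ?(ltW pi0)// addr_ge0.
  have -> : (V / (Num.sqrt (pi * (m%:R + 1 / 2)) * (n%:R - m%:R) `^ (m%:R + 1 / 2))) ^+ 2 =
      C * (n%:R - m%:R) ^- (2 * m).+1.
    rewrite expr_div_n exprMn sqr_sqrtr ?mulr_ge0 ?(ltW pi0) ?addr_ge0 ?divr_ge0//.
    rewrite -[X in _ / (_ * X)]powR_mulrn ?powR_ge0// -powRrM.
    have -> : (m%:R + 1 / 2) * 2%:R = (2 * m).+1%:R :> R.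
      by rewrite -[(2 * m).+1]addn1 natrD natrM; field.
    by rewrite powR_mulrn ?subr_ge0 ?ler_nat ?(ltnW mn)// mul1r /C -[RHS]mulrA -[in RHS]invfM.
  apply: (@legendre_err_le _ _ (fun k => C * (k%:R - m%:R) ^- (2 * m).+1)) => //.
    move=> k nk; rewrite mulr_ge0// invr_ge0 exprn_ge0// subr_ge0 ler_nat.
    by rewrite (leq_trans (ltnW mn)).
  move=> k nk; pose x : R := k.+1%:R - m%:R.
  have mk : (m < k)%N by rewrite (leq_trans mn).
  have kE : k%:R - m%:R = x - 1 :> R by rewrite /x -natr1; ring.
  have x1 : 1 < x.
    have : m.+1%:R <= k%:R :> R by rewrite ler_nat.
    by rewrite /x -!natr1; lra.
  rewrite kE -/x -mulrBr -real_normK ?num_real//.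
  have x0 : 0 < x by lra.
  have c_le := coef_le k.+1 (ltnW mk); rewrite -/x in c_le.
  have mk1 : m%:R < k.+1%:R :> R by rewrite ltr_nat ltnW.
  have w_le := hprod_le mk1; have w0 := hprod_gt0 (ltW mk1).
  rewrite -/x in w_le; move: c_le w_le w0; set w := \prod_(j < m) _ => c_le w_le w0.
  have c2 : `|legendre_coef (D 0%N) k.+1| ^+ 2 <= 4 * V ^+ 2 / (2 * pi * x) * x ^- (2 * m).
    have xm0 : 0 <= 2 * pi * x by rewrite !mulr_ge0 ?(ltW pi0) ?(ltW x0).
    have -> : 4 * V ^+ 2 / (2 * pi * x) * x ^- (2 * m) =
        (2 * V / Num.sqrt (2 * pi * x) * x ^- m) ^+ 2.
      by rewrite !expr_div_n sqr_sqrtr// [(2 * m)%N]mulnC exprM exprMn -natrX.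
    have h0 : 0 <= 2 * V / Num.sqrt (2 * pi * x) by rewrite divr_ge0 ?mulr_ge0 ?sqrtr_ge0.
    rewrite ler_sqr ?nnegrE ?mulr_ge0 ?invr_ge0 ?exprn_ge0 ?(ltW x0)//.
    by apply: le_trans c_le _; rewrite ler_wpM2l.
  have y0 : x <= k.+1%:R + 2^-1 by rewrite /x; have := ler0n R m; lra.
  apply: (@le_trans _ _ (4 * V ^+ 2 / (2 * pi * x) * x ^- (2 * m) / x)).
    by apply: ler_pM => //; rewrite ?sqr_ge0 ?invr_ge0 ?lef_pV2 ?posrE//; lra.
  have -> : 4 * V ^+ 2 / (2 * pi * x) * x ^- (2 * m) / x =
      C * ((2 * m).+1%:R / x ^+ (2 * m).+2).
    rewrite /C !exprS -[(2 * m).+1]addn1 natrD natrM.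
    clear -pi0 x0; move: (pi : R) pi0 (ler0n R m) => q q0 m0; field.
    by rewrite expf_neq0 gt_eqF// !gt_eqF// ltr_wpDl// mulr_ge0.
  by rewrite ler_wpM2l// bernoulli_pow_diff.
- move=> m1; rewrite addn1 => mn; rewrite normE.
  have [m1'|m1'] := eqVneq m 1%N.
    (* The coefficient bound carries [2 V]; the factor [2] of [inv_sqrt_telescope] turns it into
       [4 V]. *)
    apply: (@LpOmega_normy_le _ _ (fun k => 4 * V / Num.sqrt (2 * pi * (k%:R - 1)))) => //.
      by move=> k _; rewrite divr_ge0 ?mulr_ge0 ?sqrtr_ge0.
    move=> k nk; have mk : (m < k)%N by rewrite (leq_trans mn).
    have := coef_le k.+1 (ltnW mk); rewrite m1' big_ord1 subr0.
    have k1 : 1 < k%:R :> R by rewrite ltr1n -m1'.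
    have -> : k.+1%:R - 1 = k%:R :> R by rewrite -natr1 addrK.
    move=> /le_trans; apply.
    have q0 : 0 <= 2 * pi :> R by rewrite mulr_ge0// ltW.
    have sE y : Num.sqrt (2 * pi * y) = Num.sqrt (2 * pi) * Num.sqrt y :> R by rewrite sqrtrM.
    rewrite !sE; have tel := inv_sqrt_telescope k1.
    have -> : k.+1%:R - 2^-1 = k%:R + 2^-1 :> R by rewrite -[k.+1%:R]natr1; field.
    rewrite !invfM; move: tel; set s := (Num.sqrt (2 * pi))^-1.
    set u := (Num.sqrt _)^-1; set v := (Num.sqrt _)^-1 => tel.
    have s0 : 0 <= 2 * V * s by rewrite !mulr_ge0// invr_ge0 sqrtr_ge0.
    have := ler_wpM2l s0 tel; rewrite !mulrA.
    have -> : 2 * V * s * 2 * (v - u) = 4 * V * s * v - 4 * V * s * u by ring.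
    by [].
  pose q := m.-1; have mq : m = q.+1 by rewrite prednK.
  have q0 : (0 : R) < q%:R by rewrite ltr0n; lia.
  have mR : m%:R = q%:R + 1 :> R by rewrite mq natr1.
  have -> : \prod_(1 <= k < m) (1 / (n%:R - k%:R + 1 / 2)) =
      \prod_(j < q) (n%:R - j%:R - 2^-1)^-1 :> R.
    rewrite mq big_add1 big_mkord; apply: eq_bigr => j _.
    by rewrite -natr1 div1r; congr (_^-1); field.
  (* For [k >= n] the root in the bound of coefficient [k.+1] is at least [S], so it is frozen at
     [S] and only the product telescopes. *)
  set S := Num.sqrt (2 * pi * (n%:R + 1 - m%:R)).
  have nm0 : 0 < n%:R + 1 - m%:R :> R.
    by have : m%:R < n%:R :> R; [rewrite ltr_nat|lra].
  have S0 : 0 < S by rewrite sqrtr_gt0 !mulr_gt0.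
  apply: (@LpOmega_normy_le _ _ (fun k => 2 * V / (m%:R - 1) / S *
    \prod_(j < q) (k%:R - j%:R - 2^-1)^-1)) => // k nk.
    rewrite mulr_ge0 ?divr_ge0 ?mulr_ge0 ?(ltW S0)//; first by rewrite mR; lra.
    by apply/ltW/hprod_gt0; rewrite ler_nat; lia.
  have mk : (m < k)%N by rewrite (leq_trans mn).
  have qk : q.+1%:R < k.+1%:R :> R by rewrite ltr_nat; lia.
  have tel := hprod_telescope qk.
  have kE : k.+1%:R - 1 = k%:R :> R by rewrite -natr1 addrK.
  rewrite kE in tel; rewrite -mulrBr -tel mR addrK.
  have -> : 2 * V / q%:R / S * (q%:R * \prod_(j < q.+1) (k.+1%:R - j%:R - 2^-1)^-1) =
      2 * V / S * \prod_(j < q.+1) (k.+1%:R - j%:R - 2^-1)^-1.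
    by field; rewrite !gt_eqF.
  apply: le_trans (coef_le k.+1 (ltnW mk)) _; rewrite -mq.
  apply: ler_wpM2r; first by apply/ltW/hprod_gt0; rewrite ler_nat; lia.
  have kn : n%:R <= k%:R :> R by rewrite ler_nat.
  rewrite ler_wpM2l ?mulr_ge0// lef_pV2 ?posrE//.
    by rewrite ler_wsqrtr// ler_wpM2l ?mulr_ge0 ?(ltW pi0)// -[k.+1%:R]natr1; lra.
  by rewrite sqrtr_gt0 !mulr_gt0// -[k.+1%:R]natr1; lra.
Qed.
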